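(* Let $\boldsymbol\psi$ be a parabolic filtration of $\Phi$ of depth at most $r$ with Levi factor $\boldsymbol\phi$, let $\boldsymbol\lambda\in\mathfrak Z_{\boldsymbol\phi}^\vee$, let $M=M^{\boldsymbol\psi}_{\boldsymbol\lambda}$ be the finite generalised singularity module, and let $N\subseteq M$ be its unique maximal proper $U\mathfrak g_r$-submodule (the sum of all proper submodules). Then $N=\operatorname{Rad}(\mathcal S^{\boldsymbol\psi}_{\boldsymbol\lambda})$, the radical of the wild Shapovalov form $\mathcal S^{\boldsymbol\psi}_{\boldsymbol\lambda}\colon M\otimes M\to\mathbb C$.
   Context: $\mathfrak g$ is a complex reductive Lie algebra with Cartan subalgebra $\mathfrak t$, roots $\Phi$, root spaces $\mathfrak g_\alpha$. $r\ge1$, $\mathbb C_r=\mathbb C[[z]]/z^r\mathbb C[[z]]$, $\varepsilon$ = class of $z$, $\mathfrak g_r=\mathfrak g\otimes\mathbb C_r=\bigoplus_{i=0}^{r-1}\mathfrak g\varepsilon^i$. A subset $\psi\subseteq\Phi$ is parabolic if it is closed under sums within $\Phi$ and $\psi\cup(-\psi)=\Phi$. A parabolic filtration of depth at most $r$ is a sequence $\boldsymbol\psi=(\psi_i)_{i\ge0}$ of parabolic subsets with $\psi_i\subseteq\psi_{i+1}$ and $\psi_i=\Phi$ for $i\ge r$; Levi factor $\boldsymbol\phi$: $\phi_i=\psi_i\cap(-\psi_i)$. Let $\mathfrak l_{\boldsymbol\phi}=\bigoplus_{i<r}(\mathfrak t\oplus\bigoplus_{\phi_i}\mathfrak g_\alpha)\varepsilon^i$,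 $\mathfrak u^\pm_{\boldsymbol\psi}=\bigoplus_{i<r}(\bigoplus_{\alpha\in\psi_i\setminus\phi_i}\mathfrak g_{\pm\alpha})\varepsilon^i$, and $\mathfrak p_{\boldsymbol\psi}=\mathfrak l_{\boldsymbol\phi}\oplus\mathfrak u^+_{\boldsymbol\psi}$ (a Lie subalgebra); $\mathfrak g_r=\mathfrak u^-_{\boldsymbol\psi}\oplus\mathfrak l_{\boldsymbol\phi}\oplus\mathfrak u^+_{\boldsymbol\psi}$. $\mathfrak Z_{\boldsymbol\phi}^\vee$ is the set of $\boldsymbol\lambda=(\lambda_0,\dots,\lambda_{r-1})\in(\mathfrak t^\vee)^r$ with $\lambda_i(\alpha^\vee)=0$ for $\alpha\in\phi_i$; it corresponds to the characters $\boldsymbol\chi$ of $\mathfrak p_{\boldsymbol\psi}$, via $\boldsymbol\chi(X\varepsilon^i)=\lambda_i(X)$ for $X\in\mathfrak t$ and $\boldsymbol\chi=0$ on root vectors. $M^{\boldsymbol\psi}_{\boldsymbol\lambda}=U\mathfrak g_r\otimes_{U\mathfrak p_{\boldsymbol\psi}}\mathbb C_{\boldsymbol\chi}$, with canonical generator $w=1\otimes1$. Shapovalov form. Choose a base $\Delta$ of simple roots of $\Phi$ and nonzero root vectors $E_\theta\in\mathfrak g_\theta$, $\theta\in\Delta$, and let $E_{-\theta}\in\mathfrak g_{-\theta}$ be determined by $[E_\theta,E_{-\theta}]=\theta^\vee$. The transposition is the involutive antiautomorphism of $\mathfrak g$ with ${}^tX=X$ for $X\in\mathfrak t$ and ${}^tE_{\pm\theta}=E_{\mp\theta}$;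 extend it to $\mathfrak g_r$ by ${}^t(X\varepsilon^i)={}^tX\,\varepsilon^i$, and to an antiautomorphism of $U\mathfrak g_r$. In a Poincaré–Birkhoff–Witt basis of $U\mathfrak g_r$ with factors ordered as $\mathfrak u^-_{\boldsymbol\psi}$, then $\mathfrak l_{\boldsymbol\phi}$, then $\mathfrak u^+_{\boldsymbol\psi}$, let $\pi_{\boldsymbol\phi}\colon U\mathfrak g_r\to U\mathfrak l_{\boldsymbol\phi}$ be the projection killing all basis monomials containing a factor from $\mathfrak u^-_{\boldsymbol\psi}$ or $\mathfrak u^+_{\boldsymbol\psi}$. Extend $\boldsymbol\chi|_{\mathfrak l_{\boldsymbol\phi}}$ to a ring morphism $U\mathfrak l_{\boldsymbol\phi}\to\mathbb C$ and set $\mathcal S^{\boldsymbol\psi}_{\boldsymbol\lambda}(\boldsymbol X,\boldsymbol X')=\boldsymbol\chi(\pi_{\boldsymbol\phi}({}^t\boldsymbol X\cdot\boldsymbol X'))$ for $\boldsymbol X,\boldsymbol X'\in U\mathfrak g_r$. This form is symmetric and descends to $M$: $\mathcal S^{\boldsymbol\psi}_{\boldsymbol\lambda}(\boldsymbol Xw,\boldsymbol X'w)=\mathcal S^{\boldsymbol\psi}_{\boldsymbol\lambda}(\boldsymbol X,\boldsymbol X')$ is well defined. *)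

(* Defs.v *)
From mathcomp Require Export all_boot all_order all_algebra.
From mathcomp Require Export boolp classical_sets reals complex.

Set Implicit Arguments.
Unset Strict Implicit.
Unset Printing Implicit Defensive.

Import GRing.Theory.
Local Open Scope ring_scope.
Local Open Scope classical_set_scope.

Section LieAlgebras.

Variables (F : fieldType) (g : vectType F) (br : g -> g -> g).

Definition lie_bracket : Prop :=
  [/\ forall x, linear (br x),
      forall y, linear (br^~ y),
      forall x, br x x = 0
    & forall x y z, br x (br y z) + br y (br z x) + br z (br x y) = 0].

Definition ad (x : g) : 'End(g) := linfun (br x).

(* [V, W], the span of the brackets. *)
Definition lie_prod (V W : {vspace g}) : {vspace g} :=
  <<[seq br x y | x <- vbasis V, y <- vbasis W]>>%VS.

Definition lie_abelian (V : {vspace g}) : Prop :=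
  forall x y, x \in V -> y \in V -> br x y = 0.

Definition lie_solvable (V : {vspace g}) : Prop :=
  exists n, iter n (fun W => lie_prod W W) V = 0%VS.

(* The ideals of s are taken inside s; s is meant to be a subalgebra. *)
Definition lie_semisimple (s : {vspace g}) : Prop :=
  forall I : {vspace g},
    (I <= s)%VS -> (lie_prod s I <= I)%VS -> lie_solvable I -> I = 0%VS.

(* Direct sum of a semisimple ideal and an abelian ideal. *)
Definition reductive : Prop :=
  exists s a : {vspace g},
    [/\ (s + a = fullv)%VS /\ (s :&: a = 0)%VS,
        (lie_prod fullv s <= s)%VS, (lie_prod fullv a <= a)%VS,
        lie_semisimple s & lie_abelian a].

(* Over an algebraically closed field this is semisimplicity of ad x. *)
Definition ad_diagonalizable (x : g) : Prop :=
  exists2 e : seq g, basis_of fullv e &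
    forall v, v \in e -> exists c : F, br x v = c *: v.

(* In a reductive Lie algebra: a maximal abelian subalgebra of elements that
   are ad-semisimple. *)
Definition cartan (t : {vspace g}) : Prop :=
  [/\ lie_abelian t,
      forall V : {vspace g}, lie_abelian V -> (t <= V)%VS -> V = t
    & forall h, h \in t -> ad_diagonalizable h].

End LieAlgebras.

Section Roots.

Variables (F : fieldType) (g : vectType F) (br : g -> g -> g).
Variable t : {vspace g}.

Local Notation tdual := 'Hom(subvs_of t, F^o).

Implicit Types (a : tdual).

Definition root_space a : {vspace g} :=
  (\bigcap_(h <- vbasis {:subvs_of t})
     lker (ad br (vsval h) - (a h : F) *: \1%VF))%VS.

Definition is_root a : bool := (a != 0) && (root_space a != 0%VS).

(* The element of [g_a, g_-a], a line in t, on which a takes the value 2. *)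
Definition coroot a : subvs_of t :=
  xget 0 [set h | vsval h \in lie_prod br (root_space a) (root_space (- a))
                  /\ a h = 2%:R].

(* In what follows the finite set Phi of roots is given by an enumeration. *)
Variable Phi : seq tdual.

Definition root_enumeration : Prop := uniq Phi /\ Phi =i is_root.

Definition root_base (Delta : seq tdual) : Prop :=
  [/\ {subset Delta <= Phi}, free Delta
    & forall a, a \in Phi -> exists n : tdual -> nat,
        a = \sum_(d <- Delta) d *+ n d \/ a = - \sum_(d <- Delta) d *+ n d].

Definition parabolic (psi : {pred tdual}) : Prop :=
  [/\ {subset psi <= Phi},
      forall a b, a \in psi -> b \in psi -> a + b \in Phi -> a + b \in psi
    & forall a, (a \in Phi) = (a \in psi) || (- a \in psi)].

Definition parabolic_filtration (r : nat)
    (psi : nat -> {pred tdual}) : Prop :=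
  [/\ forall i, parabolic (psi i),
      forall i, {subset psi i <= psi i.+1}
    & forall i, (r <= i)%N -> psi i =i Phi].

(* Simple root vectors E th and Em th = E_{-th}. *)
Definition simple_root_vectors (Delta : seq tdual)
    (E Em : tdual -> g) : Prop :=
  forall th, th \in Delta ->
    [/\ E th \in root_space th, E th != 0, Em th \in root_space (- th)
      & br (E th) (Em th) = vsval (coroot th)].

Definition transposition (Delta : seq tdual)
    (E Em : tdual -> g) (tau : {linear g -> g}) : Prop :=
  [/\ forall x, tau (tau x) = x,
      forall x y, tau (br x y) = br (tau y) (tau x),
      forall h, h \in t -> tau h = h
    & forall th, th \in Delta -> tau (E th) = Em th /\ tau (Em th) = E th].

End Roots.

(* The truncated current algebra g_r; the i-th value of X : takiff g r is its
   coefficient on the i-th power of epsilon. *)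
Notation takiff g r := ({ffun 'I_r -> g}).

Section Takiff.

Variables (F : fieldType) (g : vectType F) (br : g -> g -> g) (r : nat).

Definition takiff_br (X Y : takiff g r) : takiff g r :=
  [ffun k : 'I_r => \sum_(i < r) \sum_(j < r | (i + j == k)%N) br (X i) (Y j)].

Definition eps (i : 'I_r) : 'Hom(g, takiff g r) :=
  linfun (fun x : g => [ffun j => if j == i then x else 0] : takiff g r).

Definition takiff_sum (V : 'I_r -> {vspace g}) : {vspace takiff g r} :=
  (\sum_(i < r) (eps i @: V i))%VS.

Definition takiff_map (f : g -> g) (X : takiff g r) : takiff g r :=
  [ffun i => f (X i)].

Variable t : {vspace g}.

Local Notation tdual := 'Hom(subvs_of t, F^o).

Variable Phi : seq tdual.
Variable psi : nat -> {pred tdual}.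

Definition levi_factor (i : nat) : {pred tdual} :=
  [pred a | (a \in psi i) && (- a \in psi i)].

Definition levi : {vspace takiff g r} :=
  takiff_sum (fun i =>
    t + \sum_(a <- Phi | a \in levi_factor i) root_space br a)%VS.

Definition nil_plus : {vspace takiff g r} :=
  takiff_sum (fun i =>
    \sum_(a <- Phi | (a \in psi i) && (a \notin levi_factor i))
      root_space br a)%VS.

Definition nil_minus : {vspace takiff g r} :=
  takiff_sum (fun i =>
    \sum_(a <- Phi | (a \in psi i) && (a \notin levi_factor i))
      root_space br (- a))%VS.

Definition parabolic_alg : {vspace takiff g r} := (levi + nil_plus)%VS.

Definition levi_central (lam : 'I_r -> tdual) : Prop :=
  forall (i : 'I_r) a, a \in levi_factor i -> lam i (coroot br a) = 0.

(* The t-component with respect to the root space decomposition of g. *)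
Definition cartan_part (x : g) : subvs_of t :=
  vsproj t (daddv_pi t (\sum_(a <- Phi) root_space br a)%VS x).

(* X eps^i |-> lam_i X for X in t, and 0 on all root vectors; its restrictions
   to levi and parabolic_alg are the characters attached to lam. *)
Definition takiff_char (lam : 'I_r -> tdual)
    (X : takiff g r) : F :=
  \sum_(i < r) (lam i (cartan_part (X i)) : F).

End Takiff.

Section Enveloping.

Variable F : fieldType.

(* (U, inc) is a universal enveloping algebra of the Lie algebra (V, br). *)
Definition enveloping (V : vectType F) (br : V -> V -> V)
    (U : algType F) (inc : {linear V -> U}) : Prop :=
  (forall x y, inc (br x y) = inc x * inc y - inc y * inc x) /\
  (forall (A : algType F) (f : {linear V -> A}),
     (forall x y, f (br x y) = f x * f y - f y * f x) ->
     exists2 h : {lrmorphism U -> A}, (forall x, h (inc x) = f x)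
       & forall h' : {lrmorphism U -> A},
           (forall x, h' (inc x) = f x) -> h' =1 h).

(* The bracket of a Lie subalgebra k. *)
Definition sub_br (V : vectType F) (br : V -> V -> V) (k : {vspace V})
    (x y : subvs_of k) : subvs_of k :=
  vsproj k (br (vsval x) (vsval y)).

(* The ordered monomial inc(s_0)^(e_0) * inc(s_1)^(e_1) * ... *)
Definition pbw_monomial (V : vectType F) (U : algType F) (inc : V -> U)
    (s : seq V) (e : 'I_(size s) -> nat) : U :=
  \prod_(k < size s) inc s`_k ^+ e k.

(* U and Ul are enveloping algebras of L and of its subalgebra l.  Given bases
   bm, bl, bu of the three summands of a decomposition L = um + l + up, this is
   the projection that kills the basis monomials of U with a factor in bm or
   bu. *)
Definition pbw_projection (L : vectType F) (l : {vspace L})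
    (U Ul : algType F) (inc : {linear L -> U})
    (incl : {linear subvs_of l -> Ul})
    (bm : seq L) (bl : seq (subvs_of l)) (bu : seq L)
    (pi : {linear U -> Ul}) : Prop :=
  forall (em : 'I_(size bm) -> nat) (el : 'I_(size bl) -> nat)
         (eu : 'I_(size bu) -> nat),
    pi (pbw_monomial inc em *
        pbw_monomial (fun x : subvs_of l => inc (vsval x)) el *
        pbw_monomial inc eu)
    = if [forall k, em k == 0%N] && [forall k, eu k == 0%N]
      then pbw_monomial incl el else 0.

Definition anti_automorphism (U : algType F) (T : {linear U -> U}) : Prop :=
  [/\ bijective T, T 1 = 1 & forall x y, T (x * y) = T y * T x].

End Enveloping.

Section InducedModules.

Variables (F : fieldType) (U P : algType F) (j : {lrmorphism P -> U}).
Variable chi : {lrmorphism P -> F^o}.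

Definition balanced (Z : zmodType) (f : U -> F -> Z) : Prop :=
  [/\ forall x y c, f (x + y) c = f x c + f y c,
      forall x c d, f x (c + d) = f x c + f x d
    & forall x p c, f (x * j p) c = f x ((chi p : F) * c)].

(* (M, ten) is the left U-module obtained by tensoring U over P with the
   one-dimensional P-module F on which P acts through chi. *)
Definition induced_module (M : lmodType U) (ten : U -> F -> M) : Prop :=
  [/\ balanced ten,
      forall u x c, ten (u * x) c = u *: ten x c
    & forall (Z : zmodType) (f : U -> F -> Z), balanced f ->
        exists2 h : {additive M -> Z}, (forall x c, h (ten x c) = f x c)
          & forall h' : {additive M -> Z},
              (forall x c, h' (ten x c) = f x c) -> h' =1 h].

End InducedModules.

Section Submodules.

Variables (U : nzRingType) (M : lmodType U).

Definition submodule (N : set M) : Prop :=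
  [/\ N 0, forall x y, N x -> N y -> N (x + y)
    & forall u x, N x -> N (u *: x)].

Definition proper_submodule (N : set M) : Prop := submodule N /\ N != setT.

Definition sum_proper_submodules : set M :=
  [set x | exists n (K : 'I_n -> set M) (y : 'I_n -> M),
     (forall k, proper_submodule (K k) /\ K k (y k)) /\ x = \sum_(k < n) y k].

End Submodules.

Arguments sum_proper_submodules {U} M.

Section Shapovalov.

Variables (F : fieldType) (U Ul : algType F).
Variables (T : {linear U -> U}) (pi : {linear U -> Ul}).
Variable chi : {lrmorphism Ul -> F^o}.

Definition shapovalov (X X' : U) : F := chi (pi (T X * X')).

(* The form induced on a module with generator w, computed on chosen
   representatives. *)
Variables (M : lmodType U) (w : M).

Definition representative (x : M) : U := xget 0 [set X | X *: w = x].

Definition shapovalov_mod (x x' : M) : F :=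
  shapovalov (representative x) (representative x').

End Shapovalov.

Definition radical (F : fieldType) (M : zmodType) (B : M -> M -> F) : set M :=
  [set x | forall y, B x y = 0].

(* Main.v *)
From HB Require Import structures.
Require Import Defs.

Set Implicit Arguments.
Unset Strict Implicit.
Unset Printing Implicit Defensive.

Import Order.TTheory GRing.Theory Num.Theory.
Import passmx.
Local Open Scope ring_scope.
Local Open Scope classical_set_scope.

(** Write Lam : U -> F for the character of the Levi factor composed with the
    projection of U onto the enveloping algebra of the Levi factor, so that the
    form is S(X, X') = Lam(T(X) X'), and let w be the generator of M.

    Lam is a matrix coefficient. The parabolic subalgebra p = l + u^+ and the
    opposite one, l + u^-, carry characters that extend the one of l by zero,
    and Lam is equivariant for both of them: Lam(u b) = Lam(u) chi(b) for b in
    U(p), and symmetrically on the left (Lam_right, Lam_left). The subspaces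
    u^+ and u^- are in general not subalgebras, so the ordered monomials are
    straightened inside p and inside its opposite only. This is done in the
    algebra U x F, where a word is paired with its value under the character
    (lie_words_span). The first equivariance turns Lam into a linear form L on
    M with L(u w) = Lam(u) (ten_functional). The two together give
    Lam(T(u)) = Lam(u) (Lam_T), because transposition exchanges p and its
    opposite and preserves the character. Hence S(x, u w) = L(T(u) x), the
    radical of S is the set of the x with L(U x) = 0, and this is a submodule
    which does not contain w (radical_form_radical, form_radical_proper).

    It remains to see that L vanishes on every proper submodule. M is spanned by
    w and by the products of one or more root vectors of u^- applied to w. By
    the inclusions psi_0 <= psi_i the roots of u^- are opposite to roots in
    psi_0 \ (- psi_0). No nonempty sum of roots of this set vanishes
    (nilradical_sum_neq0), so all these products have a weight different from
    the one of w, and polynomials in t project x to L(x) w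
    (highest_weight_projector). A submodule on which L is not zero therefore
    contains w.

    The combinatorial fact on psi_0 rests on two properties of the roots of a
    reductive Lie algebra: for each root a there is h in [g_a, g_-a] with a(h)
    nonzero (coroot_exists), and if a root b is negative on h, relative to a,
    then a + b is a weight (string_up). The second one is a trace computation on
    a root string. For the first one, root vectors in the radical of the Killing
    form span an ideal with no component in t. It is nilpotent by the theorem of
    Engel and Jacobson (engel_jacobson), hence zero (killing_radical_root). *)

(** * Straightening words in an associative algebra *)

Section Straightening.

Variables (F : fieldType) (A : algType F).

(** Spans are handled through the predicates closed under linear combinations
    that contain the generators; no coefficients have to be carried along. *)
Definition linear_pred (V : lmodType F) (P : V -> Prop) : Prop :=
  P 0 /\ forall c x y, P x -> P y -> P (c *: x + y).

Lemma linear_pred_sum (V : lmodType F) (P : V -> Prop) (I : Type) (r : seq I)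
    (c : I -> F) (x : I -> V) :
  linear_pred P -> (forall i, P (x i)) -> P (\sum_(i <- r) c i *: x i).
Proof.
move=> [P0 PD] Px; elim: r => [|i r IH]; first by rewrite big_nil.
by rewrite big_cons; apply: PD.
Qed.

Lemma linear_pred_mid (P : A -> Prop) (I : Type) (r : seq I)
    (c : I -> F) (x : I -> A) (a b : A) :
  linear_pred P -> (forall i, P (a * x i * b)) ->
  P (a * (\sum_(i <- r) c i *: x i) * b).
Proof.
move=> linP Px; rewrite mulr_sumr mulr_suml (eq_bigr (fun i => c i *: (a * x i * b))).
  exact: linear_pred_sum.
by move=> i _; rewrite -scalerAr -scalerAl.
Qed.

Definition in_span (s : seq A) (x : A) : Prop :=
  exists c : 'I_(size s) -> F, x = \sum_k c k *: s`_k.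

(** Bubble sort: the head of the target list is moved to the front by adjacent
    swaps, and the induction continues on the rest. *)
Lemma adjacent_swaps (T : eqType) (Q : seq T -> Prop) :
  (forall u a b v, Q (u ++ a :: b :: v) -> Q (u ++ b :: a :: v)) ->
  forall w w', perm_eq w w' -> Q w -> Q w'.
Proof.
move=> swapQ w; elim: w Q swapQ => [|x w IH] Q swapQ w' eq_ww'.
  by move: eq_ww'; rewrite perm_sym => /perm_nilP ->.
have: x \in w' by rewrite -(perm_mem eq_ww') mem_head.
move=> w'x; case/splitPr: w'x eq_ww' => u v eq_ww'.
have{}eq_ww': perm_eq w (u ++ v).
  by rewrite -(perm_cons x) (perm_trans eq_ww') // -cat1s perm_catCA.
move=> Qxw.
have: Q (x :: u ++ v).
  apply: (IH (fun z => Q (x :: z))) eq_ww' Qxw => u0 a b v0.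
  exact: (swapQ (x :: u0)).
have move_x u1 u2 : Q (u1 ++ x :: u2 ++ v) -> Q (u1 ++ u2 ++ x :: v).
  elim: u2 u1 => [|y u2 IHu] u1 //= /swapQ Qu.
  by have := IHu (rcons u1 y); rewrite !cat_rcons; apply.
exact: (move_x [::]).
Qed.

Variable s : seq A.
Hypothesis s_comm : forall k l : 'I_(size s),
  in_span s (s`_k * s`_l - s`_l * s`_k).

Local Notation word w := (\prod_(k <- w) s`_(nat_of_ord k)).

(** The easy half of the Poincare-Birkhoff-Witt theorem.  Swapping two
    adjacent letters changes a word by shorter words, so by induction on the
    length a word may be sorted. *)
Lemma sorted_words_span (P : A -> Prop) :
  linear_pred P ->
  (forall e : nat -> nat, P (\prod_(0 <= k < size s) s`_k ^+ e k)) ->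
  forall w : seq 'I_(size s), P (word w).
Proof.
move=> linP Psorted w; have [n] := ubnP (size w).
elim: n => // n IH in w * => /ltnSE le_wn.
have [P0 PD] := linP.
have swap_word (u v : seq 'I_(size s)) k l : (size (u ++ k :: l :: v) <= n)%N ->
    P (word (u ++ k :: l :: v)) -> P (word (u ++ l :: k :: v)).
  move=> le_n; have [c def_c] := s_comm l k.
  rewrite !big_cat !big_cons /= ![s`_l * (_ * _)]mulrA ![s`_k * (_ * _)]mulrA.
  rewrite -[s`_l * s`_k](subrK (s`_k * s`_l)) def_c mulrDl mulrDr addrC => Pw.
  rewrite -[_ + _]addrC -[X in P (X + _)]scale1r; apply: PD => //.
  rewrite mulrA; apply: linear_pred_mid => // i; rewrite -mulrA.
  suff: P (word (u ++ i :: v)) by rewrite big_cat big_cons.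
  apply: IH; apply: leq_trans le_n.
  by rewrite !size_cat /= !addnS.
(* the letters of w in increasing order *)
pose w' := flatten [seq nseq (count_mem k w) k | k <- index_enum 'I_(size s)].
have count_w' k : count_mem k w' = count_mem k w.
  rewrite count_flatten sumnE !big_map (bigD1 k) //= big1 => [|l].
    by rewrite addn0 count_nseq /= eqxx mul1n.
  by rewrite count_nseq /= => /negPf->.
have eq_ww' : perm_eq w' w.
  by apply/allP => k _ /=; rewrite count_w'.
have Pw' : P (word w').
  rewrite big_flatten big_map /=.
  have := Psorted (fun k => count_mem k [seq val l | l <- w]).
  rewrite big_mkord; congr P; apply: eq_bigr => k _.
  by rewrite big_nseq iter_mulr mulr1 count_map.
pose Q (v : seq 'I_(size s)) := (size v <= n)%N -> P (word v).
have: Q w' by move=> _; exact: Pw'.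
move/(adjacent_swaps _ eq_ww'); apply=> // u k l v Pw le.
apply: swap_word => //; first by move: le; rewrite !size_cat.
by apply: Pw; move: le; rewrite !size_cat.
Qed.

Lemma in_span_nth (k : 'I_(size s)) : in_span s s`_k.
Proof.
exists (fun l => (l == k)%:R); rewrite (bigD1 k) //= eqxx scale1r big1 ?addr0 //.
by move=> l /negPf->; rewrite scale0r.
Qed.

(** By multilinearity, straightening extends from the letters to their span. *)
Lemma products_span (P : A -> Prop) :
  linear_pred P ->
  (forall e : nat -> nat, P (\prod_(0 <= k < size s) s`_k ^+ e k)) ->
  forall xs : seq A, (forall x, x \in xs -> in_span s x) -> P (\prod_(x <- xs) x).
Proof.
move=> linP Psorted xs xs_s.
suff Pw (w : seq 'I_(size s)) : P (word w * \prod_(x <- xs) x).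
  by have := Pw [::]; rewrite big_nil mul1r.
elim: xs w xs_s => [|x xs IH] w xs_s.
  by rewrite big_nil mulr1; apply: sorted_words_span.
have /xs_s [c ->] := mem_head x xs.
rewrite big_cons mulrA; apply: linear_pred_mid => // k.
rewrite -[X in P (X * _)](_ : word (rcons w k) = _).
  by apply: IH => y xs_y; apply: xs_s; rewrite inE xs_y orbT.
by rewrite big_rcons.
Qed.

End Straightening.

(** * Generation of enveloping algebras and of induced modules *)

Section Generation.

Variables (F : fieldType) (V : vectType F) (U : algType F) (inc : V -> U).

Local Notation word xs := (\prod_(x <- xs) inc x).

(** The linear span of the words, in impredicative form: closure under products
    then follows by applying the definition twice. *)
Definition word_span (u : U) : Prop :=
  forall P : U -> Prop, linear_pred P -> (forall xs, P (word xs)) -> P u.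

Definition word_alg : {pred U} := fun u => `[< word_span u >].

Lemma word_alg_closed : GRing.subalg_closed word_alg.
Proof.
have linD c x y : word_span x -> word_span y -> word_span (c *: x + y).
  by move=> Dx Dy P linP PW; apply: linP.2; [apply: Dx | apply: Dy].
split=> [|c x y /asboolP Dx /asboolP Dy|x y /asboolP Dx /asboolP Dy];
  apply/asboolP; last 1 first.
- move=> P linP PW; have [P0 PD] := linP.
  apply: (Dx (fun z => P (z * y))) => [|xs].
    by split=> [|c a b Pa Pb]; rewrite ?mul0r // mulrDl -scalerAl; apply: PD.
  apply: (Dy (fun z => P (word xs * z))) => [|ys]; last by rewrite -big_cat.
  by split=> [|c a b Pa Pb]; rewrite ?mulr0 // mulrDr -scalerAr; apply: PD.
- by move=> P _ PW; have := PW [::]; rewrite big_nil.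
- exact: linD.
Qed.

HB.instance Definition _ :=
  GRing.isSubalgClosed.Build F U word_alg word_alg_closed.

Record word_subalg := WordSubalg {word_val :> U; _ : word_val \in word_alg}.
HB.instance Definition _ := [isSub for word_val].
HB.instance Definition _ := [Choice of word_subalg by <:].
HB.instance Definition _ := [SubChoice_isSubAlgebra of word_subalg by <:].

(** The inclusion under a name of its own, on which the linear and the
    multiplicative structures can be declared together. *)
Definition word_incl (x : word_subalg) : U := val x.
Fact word_incl_linear : linear word_incl.
Proof. exact: linearP. Qed.
Fact word_incl_monoid : monoid_morphism word_incl.
Proof. by split=> [|x y]; rewrite /word_incl ?rmorph1 ?rmorphM. Qed.
HB.instance Definition _ :=
  GRing.isLinear.Build F word_subalg U _ word_incl word_incl_linear.
HB.instance Definition _ :=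
  GRing.isMonoidMorphism.Build word_subalg U word_incl word_incl_monoid.

End Generation.

Section EnvelopingGeneration.

Variables (F : fieldType) (V : vectType F) (br : V -> V -> V).
Variables (U : algType F) (inc : {linear V -> U}).

Fact word_span_inc x : inc x \in word_alg inc.
Proof. by apply/asboolP => P _ /(_ [:: x]); rewrite big_seq1. Qed.

Definition word_inc x : word_subalg inc := WordSubalg (word_span_inc x).

Fact word_inc_linear : linear word_inc.
Proof. by move=> c x y; apply: val_inj; rewrite /= linearP. Qed.

HB.instance Definition _ :=
  GRing.isLinear.Build F V (word_subalg inc) _ word_inc word_inc_linear.

(** The words in the generators span a subalgebra; the universal map into
    this subalgebra, followed by the inclusion, is the identity by
    uniqueness. *)
Lemma enveloping_words :
  enveloping br inc -> forall u, word_span inc u.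
Proof.
move=> [inc_br env] u.
have word_br x y :
    word_inc (br x y) = word_inc x * word_inc y - word_inc y * word_inc x.
  by apply: val_inj; rewrite /= inc_br.
have [h hE _] := env (word_subalg inc) word_inc word_br.
have [h0 _ h0_uniq] := env U inc inc_br.
pose incl : {lrmorphism word_subalg inc -> U} := @word_incl _ _ _ inc.
have -> : u = incl (h u).
  rewrite -[u in LHS]/(idfun u) (h0_uniq idfun) //.
  rewrite -[RHS]/((incl \o h) u) (h0_uniq (incl \o h)) // => x.
  by rewrite /= hE.
by case: (h u) => v Dv; apply: (asboolW Dv).
Qed.

End EnvelopingGeneration.

Section InducedGeneration.

Variables (F : fieldType) (U P : algType F) (j : {lrmorphism P -> U}).
Variables (chi : {lrmorphism P -> F^o}) (M : lmodType U) (ten : U -> F -> M).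
Hypothesis M_ind : induced_module j chi ten.

Lemma tenE u c : ten u c = (c *: u) *: ten 1 1.
Proof.
have [[_ _ ten_bal] tenM _] := M_ind.
have -> : c *: u = u * j c%:A by rewrite linearZ rmorph1 /= -scalerAr mulr1.
by rewrite -tenM mulr1 ten_bal linearZ rmorph1 /= mulr1 [_ *: _]mulr1.
Qed.

Lemma ten_restrict p : j p *: ten 1 1 = (chi p)%:A *: ten 1 1.
Proof.
have [[_ _ ten_bal] tenM _] := M_ind.
by rewrite -tenE -tenM mulr1 -[j p]mul1r ten_bal mulr1.
Qed.

Definition cyclic_part : {pred M} := fun x => `[< exists u, x = u *: ten 1 1 >].

Fact cyclic_part_closed : zmod_closed cyclic_part.
Proof.
split=> [|x y /asboolP[u ->] /asboolP[v ->]]; apply/asboolP.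
  by exists 0; rewrite scale0r.
by exists (u - v); rewrite scalerBl.
Qed.

HB.instance Definition _ :=
  GRing.isZmodClosed.Build M cyclic_part cyclic_part_closed.

Record cyclic_sub := CyclicSub {cyclic_val :> M; _ : cyclic_val \in cyclic_part}.
HB.instance Definition _ := [isSub for cyclic_val].
HB.instance Definition _ := [Choice of cyclic_sub by <:].
HB.instance Definition _ := [SubChoice_isSubZmodule of cyclic_sub by <:].

Fact ten_cyclic u c : ten u c \in cyclic_part.
Proof. by apply/asboolP; exists (c *: u); exact: tenE. Qed.

(** As for enveloping algebras: the tensor product is generated by the pure
    tensors because the universal map into the subgroup that they generate is
    a section of the inclusion. *)
Lemma induced_cyclic (x : M) : exists u, x = u *: ten 1 1.
Proof.
have [[tenDl tenDr ten_bal] tenM univ] := M_ind.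
pose f u c := CyclicSub (ten_cyclic u c).
have bal_f : balanced j chi f.
  by split=> *; apply: val_inj; rewrite /= ?tenDl ?tenDr ?ten_bal.
have [h hE _] := univ cyclic_sub f bal_f.
have [h0 _ h0_uniq] := univ M ten (And3 tenDl tenDr ten_bal).
pose incl : {additive cyclic_sub -> M} := val.
have -> : x = incl (h x).
  rewrite -[x in LHS]/(idfun x) (h0_uniq idfun) //.
  rewrite -[RHS]/((incl \o h) x) (h0_uniq (incl \o h)) // => u c.
  by rewrite /= hE.
by case: (h x) => v Dv; apply: (asboolW Dv).
Qed.

End InducedGeneration.

(** * Lie algebras and the Engel-Jacobson theorem *)

Lemma linfunE (F : fieldType) (V W : vectType F) (f : V -> W) :
  linear f -> linfun f =1 f.
Proof.
move=> lin_f x; pose m := GRing.isLinear.Build F V W _ f lin_f.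
pose h : {linear V -> W} := HB.pack f m.
by rewrite (lfunE h).
Qed.

Section LieBasics.

Variables (F : fieldType) (g : vectType F) (br : g -> g -> g).
Hypothesis g_lie : lie_bracket br.

Lemma br_linearr x : linear (br x). Proof. by have [] := g_lie. Qed.
Lemma br_linearl y : linear (br^~ y). Proof. by have [] := g_lie. Qed.

Lemma brDr x : {morph br x : y z / y + z}.
Proof. by move=> y z; rewrite -[y]scale1r br_linearr !scale1r. Qed.
Lemma brDl y : {morph br^~ y : x z / x + z}.
Proof. by move=> x z /=; rewrite -[x]scale1r br_linearl !scale1r. Qed.
Lemma br0r x : br x 0 = 0.
Proof. by apply: (addrI (br x 0)); rewrite -brDr !addr0. Qed.
Lemma br0l y : br 0 y = 0.
Proof. by apply: (addrI (br 0 y)); rewrite -brDl !addr0. Qed.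
Lemma brZr c x y : br x (c *: y) = c *: br x y.
Proof. by rewrite -[c *: y]addr0 br_linearr br0r addr0. Qed.
Lemma brZl c x y : br (c *: x) y = c *: br x y.
Proof. by rewrite -[c *: x]addr0 (br_linearl y) br0l addr0. Qed.
Lemma brNr x y : br x (- y) = - br x y.
Proof. by rewrite -scaleN1r brZr scaleN1r. Qed.
Lemma brxx x : br x x = 0. Proof. by have [] := g_lie. Qed.

Lemma brC x y : br x y = - br y x.
Proof.
have := brxx (x + y); rewrite brDr !brDl !brxx add0r addr0 => /eqP.
by rewrite addrC addr_eq0 => /eqP.
Qed.

Lemma br_jacobi x y z : br x (br y z) = br (br x y) z + br y (br x z).
Proof.
have [_ _ _ jac] := g_lie; have /eqP := jac x y z.
rewrite -addrA addr_eq0 => /eqP ->.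
by rewrite [br z x]brC brNr opprD opprK [br z _]brC opprK addrC.
Qed.

Lemma br_sumr I (r : seq I) (P : pred I) x (f : I -> g) :
  br x (\sum_(i <- r | P i) f i) = \sum_(i <- r | P i) br x (f i).
Proof. exact: (big_morph (br x) (brDr x) (br0r x)). Qed.

Lemma br_suml I (r : seq I) (P : pred I) y (f : I -> g) :
  br (\sum_(i <- r | P i) f i) y = \sum_(i <- r | P i) br (f i) y.
Proof. exact: (big_morph (br^~ y) (brDl y) (br0l y)). Qed.

Lemma adE x y : ad br x y = br x y.
Proof. by rewrite /ad linfunE //; apply: br_linearr. Qed.

Lemma span_pred (P : g -> Prop) (s : seq g) :
  linear_pred P -> (forall x, x \in s -> P x) -> forall x, x \in <<s>>%VS -> P x.
Proof.
move=> linP Ps x /(coord_span (X := in_tuple s)) ->.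
by apply: linear_pred_sum => // i; apply: Ps; apply: mem_nth.
Qed.

Lemma br_vspace_linear (V : {vspace g}) x : linear_pred (fun y => br x y \in V).
Proof.
split=> [|c y z Vy Vz]; first by rewrite br0r mem0v.
by rewrite brDr brZr memvD ?memvZ.
Qed.

Lemma br_vspace_linearl (V : {vspace g}) y : linear_pred (fun x => br x y \in V).
Proof.
split=> [|c x z Vy Vz]; first by rewrite br0l mem0v.
by rewrite brDl brZl memvD ?memvZ.
Qed.

Lemma memv_pred (V : {vspace g}) : linear_pred (fun x : g => x \in V).
Proof. by split=> [|c x y Vx Vy]; rewrite ?mem0v // memvD ?memvZ. Qed.

End LieBasics.

Section Engel.

Variables (F : fieldType) (g : vectType F) (br : g -> g -> g).
Hypothesis g_lie : lie_bracket br.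

Lemma foldr_br_linear (xs : seq g) : linear_pred (fun y => foldr br y xs = 0).
Proof.
split=> [|c y z]; first by elim: xs => //= x xs ->; apply: br0r.
have -> : foldr br (c *: y + z) xs = c *: foldr br y xs + foldr br z xs.
  by elim: xs => //= x xs ->; rewrite (br_linearr g_lie).
by move=> -> ->; rewrite scaler0 addr0.
Qed.

Definition nilpotent_action (W : {pred g}) (N : nat) : Prop :=
  forall xs y, size xs = N -> {subset xs <= W} -> foldr br y xs = 0.

Section Step.

Variables (W : {vspace g}) (x : g) (N M : nat).
Hypothesis W_nil : nilpotent_action W N.
Hypothesis Wx : forall w, w \in W -> br w x \in W.
Hypothesis x_nil : forall y, iter M (br x) y = 0.

(** The filtration of g by the spans of the k-fold brackets with W. *)
Fixpoint level (k : nat) (y : g) : Prop :=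
  if k is k'.+1 then
    forall P : g -> Prop, linear_pred P ->
      (forall w z, w \in W -> level k' z -> P (br w z)) -> P y
  else True.

Lemma level_linear k : linear_pred (level k).
Proof.
case: k => [|k] //=; split=> [|c y z Ly Lz] P linP Pbr; have [P0 PD] := linP.
  exact: P0.
by apply: PD; [apply: Ly | apply: Lz].
Qed.

Lemma level_br k w z : w \in W -> level k z -> level k.+1 (br w z).
Proof. by move=> Ww Lz P _; apply. Qed.

Lemma level_decr k y : level k.+1 y -> level k y.
Proof.
elim: k y => [|k IH] y // Ly.
apply: Ly => [|w z Ww /IH Lz]; first exact: level_linear.
exact: level_br.
Qed.

(** As x normalises W, it preserves the filtration. *)
Lemma level_x k y : level k y -> level k (br x y).
Proof.
elim: k y => [|k IH] y // Ly.
apply: (Ly (fun y => level k.+1 (br x y))) => [|w z Ww Lz].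
  have [L0 LD] := level_linear k.+1.
  by split=> [|c a b La Lb]; rewrite ?(br0r g_lie) // (br_linearr g_lie); apply: LD.
rewrite (br_jacobi g_lie) -[X in level _ (X + _)]scale1r.
apply: (level_linear k.+1).2; apply: level_br => //; last exact: IH.
by rewrite (brC g_lie) rpredN Wx.
Qed.

Lemma level_top y : level N y -> y = 0.
Proof.
suff top k xs : level k y -> (k + size xs)%N = N -> {subset xs <= W} ->
    foldr br y xs = 0.
  by move=> LN; apply: (top N [::]) => //=; rewrite addn0.
elim: k y xs => [|k IH] z xs; first by move=> _ szN xsW; apply: W_nil.
move=> Lz szN xsW.
apply: (Lz (fun z => foldr br z xs = 0)) => [|w y' Ww Ly'].
  exact: foldr_br_linear.
have := IH y' (rcons xs w); rewrite foldr_rcons; apply=> //.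
  by rewrite size_rcons addnS.
by move=> v; rewrite mem_rcons inE => /predU1P[->|/xsW].
Qed.

(** Modulo the next level W acts by zero and x acts nilpotently, so that M
    factors from W + <x> are enough to go one level down. *)
Lemma level_up k y xs : level k y -> size xs = M ->
  {subset xs <= (W + <[x]>)%VS} -> level k.+1 (foldr br y xs).
Proof.
move=> Ly szM xsW.
have iter_x m : level k (iter m (br x) y).
  by elim: m => //= m; apply: level_x.
suff [c [z Lz ->]] : exists c, exists2 z, level k.+1 z &
    foldr br y xs = c *: iter (size xs) (br x) y + z.
  by rewrite szM x_nil scaler0 add0r.
elim: xs xsW {szM} => [|v xs IH] xsW.
  by exists 1, 0; [exact: (level_linear k.+1).1 | rewrite addr0 scale1r].
case: IH => [u xs_u|c [z Lz /= ->]]; first by apply: xsW; rewrite inE xs_u orbT.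
have /xsW /memv_addP[w Ww [_ /vlineP[d ->] ->]] := mem_head v xs.
exists (c * d), (c *: br w (iter (size xs) (br x) y) + (1 *: br w z + d *: br x z)).
  apply: (level_linear k.+1).2; first exact: level_br.
  apply: (level_linear k.+1).2; first by apply: level_br => //; apply: level_decr.
  rewrite -[_ *: _]addr0; apply: (level_linear k.+1).2.
    exact: (@level_x k.+1).
  exact: (level_linear k.+1).1.
rewrite scale1r (brDr g_lie) (brZr g_lie) !(brDl g_lie) !(brZl g_lie).
by rewrite scalerDr scalerA -!addrA addrCA.
Qed.

Lemma nilpotent_action_step : nilpotent_action (W + <[x]>)%VS (N * M).
Proof.
move=> xs y szN xsW; apply: level_top.
elim: N xs szN xsW => [|k IH] xs szN xsW //.
rewrite -(cat_take_drop M xs) foldr_cat; apply: level_up.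
- apply: IH; first by rewrite size_drop szN mulSn addKn.
  by move=> v /mem_drop /xsW.
- by rewrite size_takel // szN mulSn leq_addr.
by move=> v /mem_take /xsW.
Qed.

End Step.

(** A maximal subalgebra that is spanned by elements of S and acts nilpotently
    contains S, because otherwise it is normalised by some element of S outside
    it, which may be added. *)
Lemma engel_jacobson (S : g -> Prop) :
  (forall x y, S x -> S y -> S (br x y)) ->
  (forall x, S x -> exists n, forall y, iter n (br x) y = 0) ->
  exists (s : seq g) N, [/\ forall x, x \in s -> S x,
    forall x, S x -> x \in <<s>>%VS & nilpotent_action <<s>>%VS N].
Proof.
move=> S_br S_nil.
suff ext k (s : seq g) : (\dim (fullv : {vspace g}) - \dim <<s>> <= k)%N ->
    (forall x, x \in s -> S x) ->
    (forall x y, x \in <<s>>%VS -> y \in <<s>>%VS -> br x y \in <<s>>%VS) ->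
    (exists N, nilpotent_action <<s>>%VS N) ->
    exists (s : seq g) N, [/\ forall x, x \in s -> S x,
      forall x, S x -> x \in <<s>>%VS & nilpotent_action <<s>>%VS N].
  apply: (ext _ [::] (leqnn _)) => //=.
    by move=> x y; rewrite span_nil !memv0 => /eqP -> _; rewrite br0l.
  exists 1%N => -[|x []] // y _ /(_ x (mem_head _ _)).
  by rewrite span_nil memv0 => /eqP -> /=; apply: br0l.
elim: k s => [|k IH] s dim_s sS s_br [N s_nil].
  exists s, N; split=> // v _.
  suff -> : <<s>>%VS = fullv by apply: memvf.
  by apply/eqP; rewrite eqEdim subvf -subn_eq0 -leqn0.
have [sS'|] := pselect (forall x, S x -> x \in <<s>>%VS); first by exists s, N.
move/existsNP => [x0 /not_implyP[Sx0 /negP s'x0]].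
(* if no element of S outside the span normalised it, brackets with s would
   never leave the complement, against nilpotency *)
have [x [Sx s'x sx]] : exists x, [/\ S x, x \notin <<s>>%VS &
    forall w, w \in s -> br w x \in <<s>>%VS].
  apply: contrapT => nox.
  have step n : exists2 xs, size xs = n /\ {subset xs <= <<s>>%VS} &
      S (foldr br x0 xs) /\ foldr br x0 xs \notin <<s>>%VS.
    elim: n => [|n [xs [szn xss] [Sx s'x]]]; first by exists [::].
    have /existsNP[w /not_implyP[sw /negP s'w]] :
        ~ forall w, w \in s -> br w (foldr br x0 xs) \in <<s>>%VS.
      by move=> sx; apply: nox; exists (foldr br x0 xs).
    exists (w :: xs); last by split=> //; apply: S_br => //; apply: sS.
    split; first by rewrite /= szn.
    by move=> v; rewrite inE => /predU1P[->|/xss //]; apply: memv_span.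
  have [xs [szN xss] [_]] := step N.
  by rewrite (s_nil xs x0 szN xss) mem0v.
have{}sx w : w \in <<s>>%VS -> br w x \in <<s>>%VS.
  move: w; apply: (span_pred (P := fun w => br w x \in <<s>>%VS)) => //.
  exact: br_vspace_linearl.
have [M x_nil] := S_nil x Sx.
apply: (IH (x :: s)).
- rewrite span_cons -ltnS (leq_trans _ dim_s) // ltn_sub2l //; last first.
    rewrite ltn_neqAle dimvS ?addvSr // andbT.
    apply: contra s'x => /eqP eq_dim.
    suff -> : <<s>>%VS = (<[x]> + <<s>>)%VS by rewrite (subvP (addvSl _ _)) ?memv_line.
    by apply/eqP; rewrite eqEdim addvSr eq_dim leqnn.
  rewrite ltn_neqAle dimvS ?subvf // andbT; apply: contra s'x => /eqP eq_dim.
  suff -> : <<s>>%VS = fullv by apply: memvf.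
  by apply/eqP; rewrite eqEdim subvf eq_dim leqnn.
- by move=> y; rewrite inE => /predU1P[->|/sS].
- rewrite span_cons => u0 v0 /memv_addP[_ /vlineP[c ->] [u su ->]].
  move=> /memv_addP[_ /vlineP[d ->] [v sv ->]].
  rewrite !(brDl g_lie) !(brDr g_lie) !(brZl g_lie) !(brZr g_lie) brxx //.
  rewrite !scaler0 add0r (subvP (addvSr _ _)) //.
  have x_s : br x v \in <<s>>%VS by rewrite (brC g_lie) rpredN sx.
  by rewrite memvD ?memvZ // memvD ?s_br ?memvZ ?sx.
- exists (N * M)%N; rewrite span_cons addvC.
  exact: nilpotent_action_step.
Qed.

End Engel.

(** * The root space decomposition *)

Section Codiagonalization.

Variables (F : fieldType) (V : vectType F).
Local Notation n := (\dim {:V}).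

Lemma eigenbasis_diagonalizable (e0 : n.-tuple V) (e : seq V) (f : 'End(V)) :
  basis_of fullv e0 -> basis_of fullv e ->
  (forall v, v \in e -> exists c, f v = c *: v) ->
  diagonalizable (mxof e0 e0 f).
Proof.
move=> e0_basis e_basis eig.
have sz_e : size e == n.
  by rewrite -(span_basis e_basis) eq_sym; apply: basis_free e_basis.
pose e' : n.-tuple V := Tuple sz_e.
pose P := \matrix_(i < n) rVof e0 e'`_i.
have PE u : u *m P = rVof e0 (vecof e' u).
  rewrite mulmx_sum_row /vecof linear_sum; apply: eq_bigr => i _.
  by rewrite linearZ rowK.
have Pfree : row_free P.
  apply: inj_row_free => u; rewrite PE => /eqP.
  rewrite rVof_eq0 // vecof_eq0 //; first by move/eqP.
have Punit : P \in unitmx by rewrite -row_free_unit.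
exists P => //.
apply/diagonalizable_forPex.
have eig' (i : 'I_n) : exists c, f e'`_i = c *: e'`_i.
  by apply: eig; apply: mem_nth; rewrite (eqP sz_e) ltn_ord.
have /choice[c cE] := eig'.
exists (\row_i c i); apply/(simmxP Punit).
apply/row_matrixP => i; rewrite row_mul rowK -rVof_app // cE linearZ.
by rewrite row_mul row_diag_mx -scalemxAl -rowE rowK mxE.
Qed.

Lemma common_eigenbasis (fs : seq 'End(V)) :
  (forall f h, f \in fs -> h \in fs -> forall x, f (h x) = h (f x)) ->
  (forall f, f \in fs -> exists2 e : seq V, basis_of fullv e &
     forall v, v \in e -> exists c, f v = c *: v) ->
  exists2 e : n.-tuple V, basis_of fullv e &
    forall (i : 'I_n) f, f \in fs -> exists c, f e`_i = c *: e`_i.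
Proof.
move=> comm diag; pose e0 := vbasis {:V}.
have e0_basis : basis_of fullv e0 by apply: vbasisP.
have: codiagonalizable (map (mxof e0 e0) fs).
  apply/codiagonalizableP; split=> [_ _ /mapP[f fsf ->] /mapP[h fsh ->]|].
    rewrite /comm_mx -!mxof_comp //; congr mxof.
    by apply/lfunP => x; rewrite !comp_lfunE /= comm.
  move=> _ /mapP[f fsf ->]; have [e e_basis eig] := diag f fsf.
  exact: eigenbasis_diagonalizable e_basis eig.
case=> P Punit /allP diagP.
pose e := [tuple vecof e0 (row i P) | i < n].
have eE (i : 'I_n) : e`_i = vecof e0 (row i P).
  by rewrite -tnth_nth tnth_mktuple.
exists e.
  rewrite basisEfree subvf size_tuple leqnn !andbT.
  apply/freeP => k sum0 i.
  have: (\row_i k i) *m P = 0.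
    apply/eqP; rewrite -(vecof_eq0 e0_basis) mulmx_sum_row linear_sum.
    rewrite -[X in _ == X]sum0; apply/eqP; apply: eq_bigr => j _.
    by rewrite linearZ eE mxE.
  move/(congr1 (mulmx^~ (invmx P))); rewrite mulmxK // mul0mx.
  by move/rowP/(_ i); rewrite !mxE.
move=> i f fsf; rewrite eE.
have /diagP /diagonalizable_forPex[D /(simmxP Punit) PD] :
  mxof e0 e0 f \in map (mxof e0 e0) fs by apply: map_f.
exists (D 0 i); rewrite (hom_vecof e0 e0_basis) -row_mul PD row_mul row_diag_mx.
by rewrite -scalemxAl -rowE linearZ.
Qed.

End Codiagonalization.

Section Weights.

Variables (F : numFieldType) (g : vectType F) (br : g -> g -> g).
Variable t : {vspace g}.
Hypotheses (g_lie : lie_bracket br) (t_cartan : cartan br t).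

Local Notation tdual := 'Hom(subvs_of t, F^o).
Local Notation n := (\dim {:g}).

Lemma t_abelian x y : x \in t -> y \in t -> br x y = 0.
Proof. by have [ab _ _] := t_cartan; apply: ab. Qed.

(** Adding to t a line that centralises it gives an abelian algebra again. *)
Lemma t_self_centralizing x : (forall h, h \in t -> br h x = 0) -> x \in t.
Proof.
move=> cx; have [ab max _] := t_cartan.
suff <- : (t + <[x]>)%VS = t by rewrite (subvP (addvSr _ _)) ?memv_line.
apply: max; last exact: addvSl.
move=> x0 y0 /memv_addP[u tu [_ /vlineP[c ->] ->]].
move=> /memv_addP[v tv [_ /vlineP[d ->] ->]].
rewrite !(brDl g_lie) !(brDr g_lie) !(brZl g_lie) !(brZr g_lie).
rewrite (brxx g_lie) ab // cx // (brC g_lie x) cx // oppr0 !scaler0.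
by rewrite !addr0.
Qed.

(** In such a basis the root spaces and t are coordinate subspaces. *)
Definition weight_basis (e : n.-tuple g) (wt : 'I_n -> tdual) : Prop :=
  basis_of fullv e /\ forall (k : 'I_n) h, br (vsval h) e`_k = (wt k h : F) *: e`_k.

(** The operators ad h for h in t commute and are diagonalisable, so they have a
    common eigenbasis. *)
Lemma weight_basis_exists : exists e wt, weight_basis e wt.
Proof.
have [ab _ diag] := t_cartan.
have [||e e_basis eig] :=
    @common_eigenbasis F g [seq ad br h | h <- vbasis t].
- move=> _ _ /mapP[h th ->] /mapP[h' th' ->] x.
  rewrite !(adE g_lie) (br_jacobi g_lie) (ab h h') ?(br0l g_lie) ?add0r //.
    exact: vbasis_mem th.
  exact: vbasis_mem th'.
- move=> _ /mapP[h th ->]; have [e e_basis eig] := diag h (vbasis_mem th).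
  by exists e => // v /eig[c hv]; exists c; rewrite (adE g_lie).
have{}eig (k : 'I_n) h : h \in t -> exists c, br h e`_k = c *: e`_k.
  rewrite -{1}(span_basis (vbasisP t)); move: h.
  apply: (span_pred (P := fun h => exists c, br h e`_k = c *: e`_k)).
    split=> [|c x y [a xE] [b yE]].
      by exists 0; rewrite (br0l g_lie) scale0r.
    exists (c * a + b).
    by rewrite (br_linearl g_lie) xE yE scalerDl scalerA.
  move=> h th; have [|c] := eig k (ad br h); first exact: map_f.
  by rewrite (adE g_lie) => hE; exists c.
pose w (k : 'I_n) (h : subvs_of t) : F^o := coord e k (br (vsval h) e`_k).
have w_lin k : linear (w k).
  by move=> c x y; rewrite /w linearP (br_linearl g_lie) linearP.
exists e, (fun k => linfun (w k)); split=> // k h.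
rewrite linfunE // /w; have [c ->] := eig k _ (subvsP h).
by rewrite linearZ /= coord_free ?(basis_free e_basis) // eqxx mulr1.
Qed.

Section Basis.

Variables (e : n.-tuple g) (wt : 'I_n -> tdual).
Hypothesis e_wt : weight_basis e wt.

Let e_basis : basis_of fullv e. Proof. by case: e_wt. Qed.
Let e_free : free e. Proof. exact: basis_free e_basis. Qed.

Lemma br_weight (k : 'I_n) h : br (vsval h) e`_k = (wt k h : F) *: e`_k.
Proof. by case: e_wt. Qed.

Lemma coordE x : x = \sum_k coord e k x *: e`_k.
Proof. by apply: coord_basis e_basis _; rewrite memvf. Qed.

Lemma coord_br (k : 'I_n) h x : coord e k (br (vsval h) x) = (wt k h : F) * coord e k x.
Proof.
rewrite [x in LHS]coordE (br_sumr g_lie) linear_sum (bigD1 k) //= big1.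
  by rewrite (brZr g_lie) br_weight !linearZ /= coord_free // eqxx addr0 mulr1 mulrC.
move=> l /negPf ne; rewrite (brZr g_lie) br_weight !linearZ /= coord_free // ne.
by rewrite !mulr0.
Qed.

Lemma coord_inj x y : (forall k, coord e k x = coord e k y) -> x = y.
Proof. by move=> xy; rewrite (coordE x) (coordE y); apply: eq_bigr => k _; rewrite xy. Qed.

Lemma root_spaceP (a : tdual) x :
  reflect (forall h, br (vsval h) x = (a h : F) *: x) (x \in root_space br a).
Proof.
have capE (s : seq (subvs_of t)) (V : subvs_of t -> {vspace g}) :
    (x \in (\bigcap_(h <- s) V h)%VS) = all (fun h => x \in V h) s.
  elim: s => [|h s IH]; first by rewrite big_nil memvf.
  by rewrite big_cons memv_cap IH.
have kerE h : (x \in lker (ad br (vsval h) - (a h : F) *: \1%VF)) =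
    (br (vsval h) x == (a h : F) *: x).
  by rewrite memv_ker !lfun_simp (adE g_lie) subr_eq0.
rewrite capE; apply: (iffP allP) => [xa h|xa h _]; last by rewrite kerE xa.
rewrite (coord_vbasis (memvf h)) !linear_sum (br_suml g_lie) scaler_suml.
apply: eq_bigr => k _; rewrite !linearZ /= (brZl g_lie) -scalerA; congr (_ *: _).
by apply/eqP; rewrite -kerE; apply: xa; apply: mem_nth; rewrite size_tuple.
Qed.

(** Comparing coordinates of the eigenvalue equations shows that a vector of
    weight a only involves basis vectors of weight a. *)
Lemma root_space_coordP (a : tdual) x :
  x \in root_space br a <-> forall k, coord e k x != 0 -> wt k = a.
Proof.
split=> [/root_spaceP xa k xk|xa].
  apply/lfunP => h; apply: (mulIf xk).
  by rewrite -coord_br xa linearZ.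
apply/root_spaceP => h; apply: coord_inj => k.
rewrite coord_br linearZ /=; have [->|/xa ->//] := eqVneq (coord e k x) 0.
by rewrite !mulr0.
Qed.

Lemma root_space0 : root_space br (0 : tdual) = t.
Proof.
apply/vspaceP => x; apply/root_spaceP/idP => [x0|tx h].
  apply: t_self_centralizing => h th.
  by rewrite -[h](vsprojK th) x0 lfunE scale0r.
by rewrite t_abelian ?subvsP // lfunE scale0r.
Qed.

Lemma root_space_wt (k : 'I_n) : e`_k \in root_space br (wt k).
Proof. by apply/root_spaceP => h; rewrite br_weight. Qed.

Lemma br_root_space (a b : tdual) x y : x \in root_space br a -> y \in root_space br b ->
  br x y \in root_space br (a + b).
Proof.
move=> /root_spaceP xa /root_spaceP yb; apply/root_spaceP => h.
rewrite (br_jacobi g_lie) xa yb (brZl g_lie) (brZr g_lie) -scalerDl.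
by rewrite add_lfunE.
Qed.

Lemma root_space_neq0 (a : tdual) x : x \in root_space br a -> x != 0 ->
  exists k, wt k = a.
Proof.
move=> /root_space_coordP xa x0; apply: contrapT => noa.
case/eqP: x0; apply: coord_inj => k; rewrite linear0.
by have [//|/xa wtk] := eqVneq (coord e k x) 0; case: noa; exists k.
Qed.

Variable Phi : seq tdual.
Hypothesis Phi_roots : root_enumeration br Phi.

Lemma rootE (a : tdual) : (a \in Phi) = (a != 0) && (root_space br a != 0%VS).
Proof. by have [_ ->] := Phi_roots. Qed.

Lemma root_neq0 (a : tdual) : a \in Phi -> a != 0.
Proof. by rewrite rootE => /andP[]. Qed.

Lemma root_wt (a : tdual) : a \in Phi -> exists k, wt k = a.
Proof.
rewrite rootE => /andP[_ ga0].
apply: (@root_space_neq0 a (vpick (root_space br a))); first exact: memv_pick.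
by rewrite vpick0.
Qed.

Lemma e_neq0 (k : 'I_n) : e`_k != 0.
Proof. by apply: (free_not0 e_free); apply: mem_nth; rewrite size_tuple. Qed.

Lemma wt_root k : wt k != 0 -> wt k \in Phi.
Proof.
move=> wt0; rewrite rootE wt0 /=.
apply: contra (e_neq0 k) => /eqP k0.
by rewrite -memv0 -k0 root_space_wt.
Qed.

Lemma root_space_nonroot (a : tdual) : a != 0 -> a \notin Phi -> root_space br a = 0%VS.
Proof.
move=> a0 Phi'a; apply/eqP; apply: contraT => ga0; case/negP: Phi'a.
by rewrite rootE a0 ga0.
Qed.

End Basis.
End Weights.

(** * Root strings and the Killing form *)

Section Killing.

Variables (F : numFieldType) (g : vectType F) (br : g -> g -> g).
Variables (t : {vspace g}) (Phi : seq 'Hom(subvs_of t, F^o)).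
Hypotheses (g_lie : lie_bracket br) (t_cartan : cartan br t).
Hypothesis Phi_roots : root_enumeration br Phi.

Local Notation tdual := 'Hom(subvs_of t, F^o).
Local Notation n := (\dim {:g}).
Local Notation "''g_' a" := (root_space br a) (at level 8, a at level 2).

Variables (e : n.-tuple g) (wt : 'I_n -> tdual).
Hypothesis e_wt : weight_basis br e wt.

Let e_free : free e. Proof. by case: e_wt => /basis_free. Qed.

(** Rows are images of basis vectors, so products of such matrices are in the
    order opposite to the composition of the operators. *)
Definition ad_mx (x : g) : 'M[F]_n := \matrix_(k, l) coord e l (br x e`_k).

Lemma ad_mxD x y : ad_mx (x + y) = ad_mx x + ad_mx y.
Proof. by apply/matrixP => k l; rewrite !mxE (brDl g_lie) linearD. Qed.

Lemma ad_mxZ c x : ad_mx (c *: x) = c *: ad_mx x.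
Proof. by apply/matrixP => k l; rewrite !mxE (brZl g_lie) linearZ. Qed.

Lemma ad_mx_br x y : ad_mx (br x y) = ad_mx y *m ad_mx x - ad_mx x *m ad_mx y.
Proof.
have mulE u v k l : (ad_mx u *m ad_mx v) k l = coord e l (br v (br u e`_k)).
  rewrite mxE [br u _](coordE e_wt) (br_sumr g_lie) linear_sum.
  by apply: eq_bigr => i _; rewrite (brZr g_lie) linearZ !mxE.
apply/matrixP => k l; rewrite [RHS]mxE [X in _ + X]mxE !mulE mxE.
by rewrite (br_jacobi g_lie x) linearD addrK.
Qed.

Lemma ad_mx_weight a x k l : x \in 'g_a -> ad_mx x k l != 0 ->
  wt l = wt k + a.
Proof.
move=> xa; rewrite mxE addrC => nz.
have : br x e`_k \in 'g_(a + wt k).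
  by apply: (br_root_space g_lie) => //; apply: (root_space_wt g_lie e_wt).
by move/(root_space_coordP g_lie e_wt); apply.
Qed.

Lemma ad_mx_t (h : subvs_of t) k : ad_mx (vsval h) k k = wt k h.
Proof. by rewrite mxE (br_weight e_wt) linearZ /= coord_free // eqxx mulr1. Qed.

(** A commutator has trace zero on any subspace that both operators preserve;
    here the subspace is spanned by the basis vectors of index in I. *)
Lemma string_trace (a : tdual) x y (h : subvs_of t) (I : 'I_n -> Prop) :
  x \in 'g_a -> y \in 'g_(- a) -> vsval h = br x y ->
  (forall k l, wt l = wt k + a -> I k <-> I l) ->
  \sum_(k < n | `[< I k >]) (wt k h : F) = 0.
Proof.
move=> xa ya hE Iclosed.
have nzI z b k l : z \in 'g_b -> (b = a \/ b = - a) -> `[< I k >] ->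
    ~~ `[< I l >] -> ad_mx z k l = 0 /\ ad_mx z l k = 0.
  move=> zb ba /asboolP Ik /asboolPn I'l.
  split; apply/eqP; apply: contrapT => /negP /(ad_mx_weight zb) wE.
    case: ba wE => -> wE; case: I'l; first by apply/(Iclosed _ _ wE).
    by apply/(Iclosed l k); rewrite // wE subrK.
  case: ba wE => -> wE; case: I'l; first by apply/(Iclosed _ _ wE).
  by apply/(Iclosed k l); rewrite // wE subrK.
transitivity (\sum_(k < n | `[< I k >]) \sum_(l < n | `[< I l >])
    (ad_mx y k l * ad_mx x l k - ad_mx x k l * ad_mx y l k)).
  apply: eq_bigr => k Ik; rewrite -ad_mx_t hE ad_mx_br !mxE -sumrB.
  rewrite [RHS]big_mkcond; apply: eq_bigr => l _; case: ifPn => // I'l.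
  have [-> _] := nzI y (- a) k l ya (or_intror erefl) Ik I'l.
  have [-> _] := nzI x a k l xa (or_introl erefl) Ik I'l.
  by rewrite !mul0r subr0.
under eq_bigr do rewrite sumrB.
rewrite sumrB [X in _ - X]exchange_big /=; apply/eqP; rewrite subr_eq0; apply/eqP.
by apply: eq_bigr => k _; apply: eq_bigr => l _; rewrite mulrC.
Qed.

Lemma sum_wt_string (a b : tdual) (h : subvs_of t) (I : 'I_n -> Prop) (m : 'I_n -> int) :
  (forall k, I k -> wt k = b + a *~ m k) ->
  \sum_(k < n | `[< I k >]) (wt k h : F) =
    \sum_(k < n | `[< I k >]) ((b h : F) + (m k)%:~R * (a h : F)).
Proof.
move=> wtI; apply: eq_bigr => k /asboolP /wtI ->.
rewrite add_lfunE; congr (_ + _).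
have -> : a *~ m k = ((m k)%:~R : F) *: a by rewrite scaler_int.
by rewrite scale_lfunE.
Qed.

(** The trace of h on the whole string b + Z a has the form N b(h) + s a(h),
    with N positive and s an integer, and it vanishes. *)
Lemma wt_real_multiple (a : tdual) x y (h : subvs_of t) k :
  x \in 'g_a -> y \in 'g_(- a) -> vsval h = br x y ->
  exists2 q : F, q \is Num.real & wt k h = q * (a h : F).
Proof.
move=> xa ya hE; pose I l := exists m : int, wt l = wt k + a *~ m.
have Iclosed l l' : wt l' = wt l + a -> I l <-> I l'.
  move=> ll'; split=> -[m mE].
    by exists (m + 1); rewrite ll' mE mulrzDr addrA.
  by exists (m - 1); rewrite -(addrK a (wt l)) -ll' mE mulrzBr addrA.
have /choice[m mE] : forall l, exists m : int, I l -> wt l = wt k + a *~ m.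
  by move=> l; have [[m mE]|nI] := pselect (I l); [exists m | exists 0].
have := string_trace xa ya hE Iclosed.
rewrite (sum_wt_string h mE) big_split /= sumr_const -mulr_suml -[_ *+ _]mulr_natl.
set N := #|_|; set s := \sum_(_ | _) _ => /eqP; rewrite addr_eq0 => /eqP sumE.
have N0 : (N%:R : F) != 0.
  rewrite pnatr_eq0 -lt0n; apply/card_gt0P; exists k.
  by apply/asboolP; exists 0; rewrite mulr0z addr0.
exists (- (s / N%:R)).
  rewrite rpredN rpred_div ?realn // rpred_sum // => l _; exact: realz.
by apply: (mulfI N0); rewrite sumE mulNr mulrN mulrA [N%:R * _]mulrC divfK.
Qed.

(** Otherwise the weights b, b - a, b - 2a, ... that occur form a stable family
    on which h is, relative to a(h), of negative trace. *)
Lemma string_up (a : tdual) x y (h : subvs_of t) k q :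
  x \in 'g_a -> y \in 'g_(- a) -> vsval h = br x y -> (a h : F) != 0 ->
  wt k h = q * (a h : F) -> q < 0 -> exists l, wt l = wt k + a.
Proof.
move=> xa ya hE ah0 kE q0; apply: contrapT => top.
pose I l := exists m : nat, wt l = wt k + a *~ (- m%:Z).
have Iclosed l l' : wt l' = wt l + a -> I l <-> I l'.
  move=> ll'; split=> -[m mE].
    case: m mE => [|m] mE.
      by case: top; exists l'; rewrite ll' mE oppr0 mulr0z addr0.
    exists m; rewrite ll' mE -addrA; congr (_ + _).
    by rewrite -[X in _ + X]mulr1z -mulrzDr -addn1 PoszD opprD addrNK.
  exists m.+1; rewrite -(addrK a (wt l)) -ll' mE -addrA; congr (_ + _).
  by rewrite -[X in _ - X]mulr1z -mulrzBr -addn1 PoszD opprD.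
have /choice[m mE] : forall l, exists m : nat, I l -> wt l = wt k + a *~ (- m%:Z).
  by move=> l; have [[m mE]|nI] := pselect (I l); [exists m | exists 0].
have := string_trace xa ya hE Iclosed.
rewrite (sum_wt_string h mE) kE.
under eq_bigr do rewrite -mulrDl.
rewrite -mulr_suml => /eqP; rewrite mulf_eq0 (negPf ah0) orbF => /eqP sum0.
have neg l : q + (- (m l)%:Z)%:~R < 0.
  by rewrite ltr_wnDr // rmorphN /= oppr_le0 ler0n.
have Ik : `[< I k >] by apply/asboolP; exists 0; rewrite oppr0 mulr0z addr0.
have := neg k; rewrite -oppr_gt0 => posk.
have: 0 < \sum_(l < n | `[< I l >]) - (q + (- (m l)%:Z)%:~R).
  rewrite (bigD1 k) //=; apply: ltr_wpDr => //; apply: sumr_ge0 => l _.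
  by rewrite oppr_ge0 ltW.
by rewrite sumrN sum0 oppr0 ltxx.
Qed.

Definition killing (x y : g) : F := \tr (ad_mx x *m ad_mx y).

Lemma killing_br x y z : killing (br x y) z = killing x (br y z).
Proof.
rewrite /killing !ad_mx_br mulmxBl mulmxBr !raddfB /= !mulmxA; congr (_ - _).
by rewrite [RHS]mxtrace_mulC mulmxA.
Qed.

Lemma killingC x y : killing x y = killing y x.
Proof. exact: mxtrace_mulC. Qed.

Lemma killing_linear x : linear_pred (fun y => killing x y = 0).
Proof.
split=> [|c y z yE zE].
  by rewrite -[0](scale0r x) /killing ad_mxZ -scalemxAr scale0r raddf0.
rewrite /killing ad_mxD ad_mxZ mulmxDr -scalemxAr raddfD /= mxtraceZ.
by move: yE zE; rewrite /killing => -> ->; rewrite mulr0 addr0.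
Qed.

(** Invariance under h gives (a + b)(h) killing(x, y) = 0. *)
Lemma killing_weights (a b : tdual) x y : x \in 'g_a -> y \in 'g_b ->
  a + b != 0 -> killing x y = 0.
Proof.
move=> xa yb ab0; apply: contrapT => /eqP nz; case/eqP: ab0; apply/lfunP => h.
rewrite add_lfunE lfunE /=; apply: (mulIf nz); rewrite mul0r.
have scal c u v : killing (c *: u) v = c * killing u v.
  by rewrite /killing ad_mxZ -scalemxAl mxtraceZ.
have := killing_br x (vsval h) y.
have /(root_spaceP g_lie) := xa; have /(root_spaceP g_lie) := yb => -> xE.
rewrite (brC g_lie) xE -scaleNr scal [RHS]killingC scal [killing y _]killingC.
by move/eqP; rewrite mulNr eqr_oppLR -addr_eq0 -mulrDl => /eqP.
Qed.

End Killing.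

(** * Nilradicals of parabolic sets of roots *)

Section LieProd.

Variables (F : fieldType) (g : vectType F) (br : g -> g -> g).
Hypothesis g_lie : lie_bracket br.

Lemma lie_prod_ind (V W : {vspace g}) (P : g -> Prop) :
  linear_pred P -> (forall x y, x \in V -> y \in W -> P (br x y)) ->
  forall z, z \in lie_prod br V W -> P z.
Proof.
move=> linP Pbr; apply: span_pred => // _ /allpairsP[[x y] [/= Vx Wy ->]].
by apply: Pbr; apply: vbasis_mem.
Qed.

Lemma lie_prod_sub (V W Z : {vspace g}) :
  (forall x y, x \in V -> y \in W -> br x y \in Z) -> (lie_prod br V W <= Z)%VS.
Proof.
by move=> VWZ; apply/subvP; apply: lie_prod_ind => //; apply: memv_pred.
Qed.

Lemma mem_lie_prod (V W : {vspace g}) x y :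
  x \in V -> y \in W -> br x y \in lie_prod br V W.
Proof.
move=> /coord_vbasis -> /coord_vbasis ->.
rewrite (br_suml g_lie); apply: memv_suml => i _.
rewrite (brZl g_lie) (br_sumr g_lie) memvZ //; apply: memv_suml => k _.
rewrite (brZr g_lie) memvZ // memv_span //; apply: allpairs_f;
  by apply: mem_nth; rewrite size_tuple.
Qed.

(** The derived series is dominated by the lower central series. *)
Lemma nilpotent_solvable (W : {vspace g}) N :
  (forall x y, x \in W -> y \in W -> br x y \in W) ->
  nilpotent_action br W N -> lie_solvable br W.
Proof.
move=> W_br W_nil; exists N; pose D m := iter m (fun V => lie_prod br V V) W.
have DW m : (D m <= W)%VS.
  elim: m => [|m IH]; first exact: subvv.
  by apply: lie_prod_sub => x y /(subvP IH) Wx /(subvP IH) Wy; apply: W_br.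
have D0 m y xs : y \in D m -> (m + size xs)%N = N -> {subset xs <= W} ->
    foldr br y xs = 0.
  elim: m y xs => [|m IH] y xs Dy szN xsW; first exact: W_nil.
  move: y Dy; apply: lie_prod_ind; first exact: foldr_br_linear.
  move=> x y Dx Dy; have := IH y (rcons xs x) Dy; rewrite foldr_rcons; apply.
    by rewrite size_rcons addnS.
  by move=> z; rewrite mem_rcons inE => /predU1P[->|/xsW //]; apply: (subvP (DW m)).
apply/eqP; rewrite -subv0; apply/subvP => y Dy; rewrite memv0; apply/eqP.
by apply: (D0 N y [::]) => //; rewrite addn0.
Qed.

Lemma reductive_derived : reductive br ->
  exists s : {vspace g}, (forall x y, br x y \in s) /\ lie_semisimple br s.
Proof.
move=> [s [a [[sum_sa _] s_ideal a_ideal ss a_ab]]]; exists s; split=> // x y.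
have := memvf x; rewrite -sum_sa => /memv_addP[u su [v av ->]].
have := memvf y; rewrite -sum_sa => /memv_addP[w sw [z az ->]].
have sr p q : q \in s -> br p q \in s.
  by move=> sq; apply: (subvP s_ideal); apply: mem_lie_prod; rewrite ?memvf.
rewrite (brDr g_lie) (brDl g_lie z u v) (a_ab v z) // addr0.
have s_uz : br u z \in s by rewrite (brC g_lie) rpredN sr.
by rewrite memvD // sr.
Qed.

Lemma semisimple_central (s : {vspace g}) x :
  lie_semisimple br s -> x \in s -> (forall y, br y x = 0) -> x = 0.
Proof.
move=> ss sx cx; apply/eqP.
suff -> : (x == 0) = (<[x]> == 0)%VS.
  apply/eqP; apply: ss; first by rewrite -memvE.
    apply: lie_prod_sub => y _ _ /vlineP[c ->].
    by rewrite (brZr g_lie) cx scaler0 mem0v.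
  exists 1%N => /=; apply/eqP; rewrite -subv0; apply: lie_prod_sub.
  move=> y _ _ /vlineP[c ->].
  by rewrite (brZr g_lie) cx scaler0 mem0v.
by rewrite -dimv_eq0 dim_vline; case: eqP.
Qed.

End LieProd.

Section Coroots.

Variables (F : numFieldType) (g : vectType F) (br : g -> g -> g).
Variables (t : {vspace g}) (Phi : seq 'Hom(subvs_of t, F^o)).
Hypotheses (g_lie : lie_bracket br) (t_cartan : cartan br t).
Hypothesis Phi_roots : root_enumeration br Phi.
Hypothesis g_red : reductive br.

Local Notation tdual := 'Hom(subvs_of t, F^o).
Local Notation n := (\dim {:g}).
Local Notation "''g_' a" := (root_space br a) (at level 8, a at level 2).

Variables (e : n.-tuple g) (wt : 'I_n -> tdual).
Hypothesis e_wt : weight_basis br e wt.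

Local Notation B := (killing br e).

(** When a(h) = 0 all roots vanish at h, being multiples of a there; then h is
    central, hence zero in the semisimple part. *)
Lemma root_killed_br_eq0 (a : tdual) x y (h : subvs_of t) :
  x \in 'g_a -> y \in 'g_(- a) -> vsval h = br x y -> (a h : F) = 0 -> br x y = 0.
Proof.
move=> xa ya hE ah0; have [s [s_br ss]] := reductive_derived g_lie g_red.
apply: (semisimple_central g_lie ss); first exact: s_br.
move=> z; rewrite (brC g_lie) -hE; apply/eqP; rewrite oppr_eq0; apply/eqP.
apply: (coord_inj e_wt) => k; rewrite (coord_br g_lie e_wt) linear0.
by have [q _ ->] := wt_real_multiple g_lie e_wt k xa ya hE; rewrite ah0 mulr0 mul0r.
Qed.

Lemma br_opp_root (a : tdual) x y : x \in 'g_a -> y \in 'g_(- a) ->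
  exists h : subvs_of t, vsval h = br x y.
Proof.
move=> xa ya; have := br_root_space g_lie xa ya.
by rewrite subrr (root_space0 g_lie t_cartan) => /vsprojK E; exists (vsproj t (br x y)).
Qed.

(** For h = [x, y] the trace of (ad h)^2 is zero, and it is a(h)^2 times a sum
    of squares of real numbers, one of which is 1. *)
Lemma killing_radical_br (a : tdual) x y : x \in 'g_a -> y \in 'g_(- a) ->
  (forall z, B x z = 0) -> br x y = 0.
Proof.
move=> xa ya Bx; have [->|x0] := eqVneq x 0; first exact: (br0l g_lie).
have [h hE] := br_opp_root xa ya.
apply: (root_killed_br_eq0 xa ya hE).
have q_ex k : exists q, q \is Num.real /\ wt k h = q * (a h : F).
  by have [q] := wt_real_multiple g_lie e_wt k xa ya hE; exists q.
have [q qE] := choice q_ex.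
have := killing_br g_lie e_wt x y (br x y); rewrite Bx -hE.
have -> : B (vsval h) (vsval h) = \sum_k (q k * (a h : F)) ^+ 2.
  rewrite /killing; apply: eq_bigr => k _.
  have ad_h i l : ad_mx br e (vsval h) i l = (i == l)%:R * (wt i h : F).
    by rewrite mxE (br_weight e_wt) linearZ /= coord_free ?(basis_free e_wt.1) // mulrC.
  rewrite mxE (bigD1 k) //= big1 ?addr0 => [|l /negPf lk].
    by rewrite !ad_h eqxx mul1r (qE k).2 expr2.
  by rewrite ad_h eq_sym lk !mul0r.
under eq_bigr do rewrite exprMn.
move=> /eqP; rewrite -mulr_suml mulf_eq0 expf_eq0 /= => /orP[/eqP sum0|/eqP //].
have [k wtk] := root_space_neq0 g_lie e_wt xa x0.
have q0 : q k ^+ 2 = 0.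
  move: (k) isT; apply: psumr_eq0P sum0 => l _.
  by apply: real_exprn_even_ge0 => //; case: (qE l).
have := (qE k).2; rewrite wtk => ->.
by move/eqP: q0; rewrite expf_eq0 => /eqP ->; rewrite mul0r.
Qed.

(** Repeated brackets with x run through the different weights b + m a. *)
Lemma ad_root_nilpotent (a : tdual) x : a != 0 -> x \in 'g_a ->
  exists m, forall y, iter m (br x) y = 0.
Proof.
move=> a0 xa.
have iter_wt m (k : 'I_n) : iter m (br x) e`_k \in 'g_(wt k + a *+ m).
  elim: m => [|m IH] /=; first by rewrite addr0; apply: (root_space_wt g_lie e_wt).
  by rewrite mulrS addrCA; apply: br_root_space.
have iterE m y : iter m (br x) y = foldr br y (nseq m x) by elim: m => //= m ->.
exists n => y; rewrite iterE [y](coordE e_wt).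
apply: (linear_pred_sum (P := fun y => foldr br y (nseq n x) = 0)) => [|k].
  exact: foldr_br_linear.
rewrite -iterE; apply: contrapT => /eqP nz.
(* otherwise n + 1 different weights would occur in a basis of length n *)
have nz_m (m : 'I_n.+1) : exists l, wt l = wt k + a *+ m.
  apply: (root_space_neq0 g_lie e_wt (iter_wt m k)).
  apply: contra nz => /eqP iter0; have le_mn := ltnSE (ltn_ord m).
  have -> z : iter n (br x) z = iter (n - m) (br x) (iter m (br x) z).
    by rewrite -iterD subnK.
  by rewrite iter0 iterE; apply/eqP; exact: (foldr_br_linear g_lie _).1.
have [f fE] := choice nz_m.
suff /leq_card : injective f by rewrite !card_ord ltnn.
move=> m m' /(congr1 wt); rewrite !fE => /addrI; rewrite -!scaler_nat.
move/eqP; rewrite -subr_eq0 -scalerBl scaler_eq0 (negPf a0) orbF subr_eq0.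
by rewrite eqr_nat => /eqP/val_inj.
Qed.

(** The root vectors in the radical of the Killing form are closed under
    brackets and their span is an ideal, which has no component in t. By the
    Engel-Jacobson theorem it is nilpotent, so it vanishes because it lies in
    the semisimple part. *)
Lemma killing_radical_root (a : tdual) x : a \in Phi -> x \in 'g_a ->
  (forall z, B x z = 0) -> x = 0.
Proof.
pose S x := exists b : tdual, [/\ b \in Phi, x \in 'g_b & forall z, B x z = 0].
have S_br_root (b : tdual) u y : b \in Phi \/ b = 0 -> S u -> y \in 'g_b ->
    br u y = 0 \/ S (br u y).
  move=> Phi_b [c [Phi_c uc Bu]] yb.
  have ubc : br u y \in 'g_(c + b) by apply: br_root_space.
  have Bbr z : B (br u y) z = 0 by rewrite (killing_br g_lie e_wt).
  have [cb0|cb0] := eqVneq (c + b) 0.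
    left; apply: (killing_radical_br (a := c)) => //.
    by have -> : - c = b by apply/eqP; rewrite eq_sym -addr_eq0 addrC cb0.
  have [Phi_cb|Phi'cb] := boolP (c + b \in Phi); first by right; exists (c + b).
  move: ubc; rewrite (root_space_nonroot Phi_roots cb0 Phi'cb) memv0 => /eqP ->.
  by left.
have S0 (b : tdual) : b \in Phi -> S 0.
  move=> Phi_b; exists b; split=> // [|z]; first exact: mem0v.
  rewrite (killingC br e); exact: (killing_linear g_lie e z).1.
have S_br u v : S u -> S v -> S (br u v).
  move=> Su Sv; have [c [Phi_c vc _]] := Sv.
  by have [->|//] := S_br_root c u v (or_introl Phi_c) Su vc; apply: S0 Phi_c.
have S_nil u : S u -> exists m, forall y, iter m (br u) y = 0.
  move=> [c [Phi_c uc _]]; apply: ad_root_nilpotent uc.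
  exact: (root_neq0 Phi_roots Phi_c).
have [s [N [sS Ss s_nil]]] := engel_jacobson g_lie S_br S_nil.
have [sr [sr_br ss]] := reductive_derived g_lie g_red.
have s_ideal z u : u \in <<s>>%VS -> br z u \in <<s>>%VS.
  move: u; apply: (span_pred (P := fun u => br z u \in <<s>>%VS)).
    exact: br_vspace_linear.
  move=> u /sS Su; rewrite (brC g_lie) rpredN [z](coordE e_wt) (br_sumr g_lie).
  apply: memv_suml => k _; rewrite (brZr g_lie) memvZ //.
  have wtk : wt k \in Phi \/ wt k = 0.
    have [|/(wt_root g_lie e_wt Phi_roots)] := eqVneq (wt k) 0; first by right.
    by left.
  have [->|/Ss //] := S_br_root _ _ _ wtk Su (root_space_wt g_lie e_wt k).
  exact: mem0v.
have s_sr : (<<s>> <= sr)%VS.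
  apply/span_subvP => u /sS [c [Phi_c uc _]].
  have /eqP := root_neq0 Phi_roots Phi_c; rewrite -[c = 0]/(_) => c0.
  have [h ch] : exists h, (c h : F) != 0.
    apply: contrapT => noh; apply: c0; apply/lfunP => h; rewrite lfunE /=.
    by apply: contrapT => /eqP ch; apply: noh; exists h.
  have -> : u = (c h : F)^-1 *: br (vsval h) u.
    by have /(root_spaceP g_lie) -> := uc; rewrite scalerA mulVf // scale1r.
  by rewrite memvZ.
have s0 : <<s>>%VS = 0%VS.
  apply: ss s_sr _ _.
    by apply: lie_prod_sub => u v _; apply: s_ideal.
  by apply: (nilpotent_solvable g_lie) s_nil => u v _; apply: s_ideal.
move=> Phi_a xa Bx; apply/eqP; rewrite -memv0 -s0.
by apply: Ss; exists a.
Qed.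

(** A root vector x is not in the radical of the Killing form, so some y of
    weight -a has killing(x, y) nonzero. Invariance makes [x, y] nonzero, and
    then a cannot vanish on it. *)
Lemma coroot_exists (a : tdual) : a \in Phi -> exists x y (h : subvs_of t),
  [/\ x \in 'g_a, y \in 'g_(- a), vsval h = br x y & (a h : F) != 0].
Proof.
move=> Phi_a; have := Phi_a; rewrite (rootE Phi_roots) => /andP[a0 ga0].
pose x := vpick 'g_a; have xa : x \in 'g_a by apply: memv_pick.
have x0 : x != 0 by rewrite vpick0.
have [k Bk] : exists k : 'I_n, B x e`_k != 0.
  apply: contrapT => noB; case/eqP: x0; apply: (killing_radical_root Phi_a xa) => z.
  rewrite [z](coordE e_wt); apply: (linear_pred_sum (P := fun z => B x z = 0)).
    exact: killing_linear.
  by move=> k; apply: contrapT => /eqP Bk; apply: noB; exists k.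
have ya : e`_k \in 'g_(- a).
  have -> : - a = wt k; last exact: (root_space_wt g_lie e_wt).
  apply/eqP; rewrite eq_sym -addr_eq0 addrC; apply: contraNT Bk => akn.
  apply/eqP; apply: (killing_weights g_lie e_wt xa _ akn).
  exact: (root_space_wt g_lie e_wt).
have [h hE] := br_opp_root xa ya; exists x, e`_k, h; split=> //.
apply/eqP => ah0.
have xy0 := root_killed_br_eq0 xa ya hE ah0.
have [h' ah'] : exists h', (a h' : F) != 0.
  apply: contrapT => noh; case/eqP: a0; apply/lfunP => h'; rewrite lfunE /=.
  by apply: contrapT => /eqP ch; apply: noh; exists h'.
have := killing_br g_lie e_wt (vsval h') x e`_k.
rewrite xy0 (killing_linear g_lie e _).1.
have /(root_spaceP g_lie) -> := xa.
rewrite killingC => /eqP; apply/negP.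
have [P0 PD] := killing_linear g_lie e e`_k.
apply: contra ah' => /eqP; rewrite /killing (ad_mxZ g_lie) -scalemxAr mxtraceZ.
move/eqP; rewrite mulf_eq0 => /orP[//|]; rewrite -/(killing br e _ _) killingC.
by rewrite (negPf Bk).
Qed.

End Coroots.

Section ParabolicNilradical.

Variables (F : numFieldType) (g : vectType F) (br : g -> g -> g).
Variables (t : {vspace g}) (Phi : seq 'Hom(subvs_of t, F^o)).
Hypotheses (g_lie : lie_bracket br) (t_cartan : cartan br t).
Hypothesis Phi_roots : root_enumeration br Phi.
Hypothesis g_red : reductive br.

Local Notation tdual := 'Hom(subvs_of t, F^o).

Variable psi : {pred tdual}.
Hypothesis psi_parabolic : parabolic Phi psi.

Lemma root_opp (a : tdual) : (- a \in Phi) = (a \in Phi).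
Proof. by have [_ _ E] := psi_parabolic; rewrite !E opprK orbC. Qed.

(** In a vanishing sum some summand b would be negative on the coroot of the
    first one, a. The pair could be replaced by a + b, which is a root of the
    nilradical again, and this would give a shorter vanishing sum. *)
Lemma nilradical_sum_neq0 (s : seq tdual) :
  (forall a, a \in s -> (a \in psi) && (- a \notin psi)) -> s != [::] ->
  \sum_(a <- s) a != 0.
Proof.
have [sub closed cover] := psi_parabolic.
have [e [wt e_wt]] := weight_basis_exists g_lie t_cartan.
have [m] := ubnP (size s); elim: m s => // m IH [//|a s] /= /ltnSE le_s nil_s _.
have /andP[psi_a psi'a] := nil_s a (mem_head _ _).
have [x [y [h [xa ya hE ah0]]]] :=
  coroot_exists g_lie t_cartan Phi_roots g_red e_wt (sub a psi_a).
apply/eqP => sum0.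
have s_psi b : b \in s -> (b \in psi) && (- b \notin psi).
  by move=> sb; apply: nil_s; rewrite inE sb orbT.
have q_ex (b : tdual) : exists q, b \in s -> q \is Num.real /\ b h = q * (a h : F).
  have [sb|_] := boolP (b \in s); last by exists 0.
  have /andP[/sub /(root_wt g_lie e_wt Phi_roots)[k <-] _] := s_psi b sb.
  by have [q] := wt_real_multiple g_lie e_wt k xa ya hE; exists q.
have [q qE] := choice q_ex.
have [b sb qb] : exists2 b, b \in s & q b < 0.
  apply: contrapT => noneg; have q_ge0 b : b \in s -> 0 <= q b.
    move=> sb; rewrite real_leNgt ?real0 //; last by case: (qE b sb).
    by apply/negP => qb; apply: noneg; exists b.
  move/lfunP: sum0 => /(_ h); rewrite sum_lfunE lfunE /= big_cons.
  rewrite (eq_big_seq (fun b => q b * (a h : F))); last first.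
    by move=> b sb; case: (qE b sb).
  rewrite -mulr_suml -[X in X + _]mul1r -mulrDl => /eqP.
  rewrite mulf_eq0 (negPf ah0) orbF; apply/negP; rewrite gt_eqF //.
  apply: ltr_pwDl; first exact: ltr01.
  by rewrite big_seq; apply: sumr_ge0.
have /andP[psi_b psi'b] := s_psi b sb.
have [k kb] := root_wt g_lie e_wt Phi_roots (sub b psi_b).
have [l lE] : exists l, wt l = wt k + a.
  apply: (string_up g_lie e_wt xa ya hE ah0 _ qb).
  by rewrite kb; case: (qE b sb).
have ba0 : b + a != 0.
  apply: contra psi'a; rewrite addrC addr_eq0 => /eqP ->.
  by rewrite opprK.
have Phi_ba : b + a \in Phi.
  by rewrite -kb -lE; apply: (wt_root g_lie e_wt Phi_roots); rewrite lE kb.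
have psi_ba : b + a \in psi by apply: closed.
have psi'ba : - (b + a) \notin psi.
  apply: contra psi'a => psi_nba.
  have -> : - a = - (b + a) + b by rewrite opprD addrAC addNr add0r.
  apply: closed => //; rewrite opprD addrAC addNr add0r root_opp.
  exact: sub.
suff : \sum_(c <- b + a :: rem b s) c != 0.
  case/eqP; rewrite -[RHS]sum0 !big_cons (perm_big _ (perm_to_rem sb)) big_cons.
  by rewrite addrA [b + a]addrC.
apply: IH => // [|c].
  by rewrite /= size_rem // prednK //; case: (s) sb.
rewrite inE => /predU1P[->|/mem_rem /s_psi //].
by rewrite psi_ba.
Qed.

End ParabolicNilradical.

(** * Functionals on an enveloping algebra with a triangular decomposition *)

Section Monomials.

Variables (F : fieldType) (V : vectType F).

Definition monomial (A : pzSemiRingType) (f : V -> A) (b : seq V) (e : nat -> nat) : A :=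
  \prod_(0 <= k < size b) f b`_k ^+ e k.

Lemma monomial_cat (A : pzSemiRingType) (f : V -> A) b c e :
  monomial f (b ++ c) e =
  monomial f b e * monomial f c (fun k => e (size b + k)%N).
Proof.
rewrite /monomial size_cat (big_cat_nat _ (n := size b)) ?leq_addr //=.
congr (_ * _).
  by apply: eq_big_nat => k /andP[_ kb]; rewrite nth_cat kb.
rewrite -{1}[size b]add0n big_addn addKn; apply: eq_bigr => k _.
by rewrite nth_cat addnC ltnNge leq_addr /= addKn.
Qed.

Definition monomial_seq (b : seq V) (e : nat -> nat) : seq V :=
  flatten [seq nseq (e k) b`_k | k <- index_iota 0 (size b)].

Lemma monomial_seq_sub b e : {subset monomial_seq b e <= b}.
Proof.
move=> x /flatten_mapP[k]; rewrite mem_index_iota => /andP[_ kb].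
by rewrite mem_nseq => /andP[_ /eqP ->]; apply: mem_nth.
Qed.

Lemma monomialE (A : pzSemiRingType) (f : V -> A) b e :
  monomial f b e = \prod_(x <- monomial_seq b e) f x.
Proof.
rewrite big_flatten big_map; apply: eq_bigr => k _.
by rewrite big_nseq iter_mulr mulr1.
Qed.

Lemma in_span_linear (A : algType F) (s : seq A) : linear_pred (in_span s).
Proof.
split=> [|c x y [a ->] [b ->]].
  by exists (fun=> 0); rewrite big1 // => k _; rewrite scale0r.
exists (fun k => c * a k + b k); rewrite scaler_sumr -big_split.
by apply: eq_bigr => k _; rewrite scalerDl scalerA.
Qed.

Lemma in_span_image (A : algType F) (f : {linear V -> A}) (b : seq V) x :
  x \in <<b>>%VS -> in_span (map f b) (f x).
Proof.
move: x; apply: (span_pred (P := fun x => in_span (map f b) (f x))).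
  have [H0 HD] := in_span_linear (map f b).
  by split=> [|c x y Hx Hy]; rewrite ?linear0 // linearP; apply: HD.
move=> x bx; have fbx : f x \in map f b by apply: map_f.
have lt_fx : (index (f x) (map f b) < size (map f b))%N by rewrite index_mem.
have := in_span_nth (Ordinal lt_fx).
by rewrite /= nth_index.
Qed.

Variable br : V -> V -> V.

(** Straightening inside a Lie subalgebra, for a map f that needs to respect
    brackets only there. *)
Lemma lie_words_span (A : algType F) (f : {linear V -> A}) (b : seq V) :
  (forall x y, x \in <<b>>%VS -> y \in <<b>>%VS -> br x y \in <<b>>%VS) ->
  (forall x y, x \in <<b>>%VS -> y \in <<b>>%VS ->
     f (br x y) = f x * f y - f y * f x) ->
  forall P : A -> Prop, linear_pred P -> (forall e, P (monomial f b e)) ->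
  forall xs, {subset xs <= <<b>>%VS} -> P (\prod_(x <- xs) f x).
Proof.
move=> b_br f_br P linP Pmon xs xsb.
have nthE k : (k < size b)%N -> (map f b)`_k = f b`_k.
  by move=> kb; rewrite (nth_map 0).
rewrite -(big_map f xpredT id); apply: (products_span (s := map f b)) => //.
- move=> k l; have [kb lb] : (k < size b)%N /\ (l < size b)%N.
    by rewrite -(size_map f b) !ltn_ord.
  have bk m : (m < size b)%N -> b`_m \in <<b>>%VS.
    by move=> mb; apply: memv_span; apply: mem_nth.
  by rewrite !nthE // -f_br ?bk //; apply: in_span_image; apply: b_br; apply: bk.
- move=> e; have := Pmon e; rewrite /monomial size_map; congr P.
  by apply: eq_big_nat => k /andP[_ kb]; rewrite nthE.
by move=> _ /mapP[x xs_x ->]; apply: in_span_image; apply: xsb.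
Qed.

End Monomials.

Section Triangular.

Variables (F : fieldType) (V : vectType F) (br : V -> V -> V).
Variables (U : algType F) (inc : {linear V -> U}).
Hypothesis U_env : enveloping br inc.

Variables bm bl bu : seq V.
Hypothesis decomp : (<<bm>> + <<bl>> + <<bu>> = fullv :> {vspace V})%VS.

(** U is spanned by the monomials ordered along the decomposition. *)
Lemma triangular_ind (P : U -> Prop) : linear_pred P ->
  (forall em el eu,
     P (monomial inc bm em * monomial inc bl el * monomial inc bu eu)) ->
  forall u, P u.
Proof.
move=> linP Pmon u; apply: (enveloping_words U_env) => // xs.
have b_full : <<bm ++ bl ++ bu>>%VS = fullv.
  by rewrite !span_cat addvA.
apply: (lie_words_span (br := br) (b := bm ++ bl ++ bu)) => //.
- by move=> x y _ _; rewrite b_full memvf.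
- by move=> x y _ _; apply: U_env.1.
- by move=> e; rewrite !monomial_cat mulrA; apply: Pmon.
by move=> x _; rewrite b_full memvf.
Qed.

Variable chi : {linear V -> F^o}.

(** Straightening in U x F keeps track of a word and of the value of the
    character on it at the same time. *)
Definition inc_chi (x : V) : U * F^o := (inc x, chi x).

Fact inc_chi_linear : linear inc_chi.
Proof. by move=> c x y; rewrite /inc_chi !linearP. Qed.

HB.instance Definition _ :=
  GRing.isLinear.Build F V (U * F^o)%type _ inc_chi inc_chi_linear.

Lemma inc_chi_prod (xs : seq V) :
  \prod_(x <- xs) inc_chi x =
    (\prod_(x <- xs) inc x, \prod_(x <- xs) chi x) :> U * F^o.
Proof. by elim: xs => [|x xs IH]; rewrite ?big_nil // !big_cons IH. Qed.

Lemma inc_chi_monomial b e :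
  monomial inc_chi b e = (monomial inc b e, monomial chi b e) :> U * F^o.
Proof.
by rewrite !monomialE inc_chi_prod.
Qed.

Local Notation parab := <<bl ++ bu>>%VS.
Local Notation opp_parab := <<bm ++ bl>>%VS.

(* Only the two subalgebras bl + bu and bm + bl are closed under brackets; bm
   and bu need not span subalgebras. *)
Hypothesis parab_br : forall x y, x \in parab -> y \in parab ->
  br x y \in parab /\ chi (br x y) = 0.
Hypothesis opp_parab_br : forall x y, x \in opp_parab -> y \in opp_parab ->
  br x y \in opp_parab /\ chi (br x y) = 0.

Lemma inc_chi_br x y : chi (br x y) = 0 ->
  inc_chi (br x y) = inc_chi x * inc_chi y - inc_chi y * inc_chi x.
Proof.
move=> chi0; rewrite /inc_chi U_env.1 chi0; congr (_, _).
by rewrite /= [chi x * _]mulrC subrr.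
Qed.

Variable Lam : {linear U -> F^o}.
Hypothesis LamE : forall em el eu,
  Lam (monomial inc bm em * monomial inc bl el * monomial inc bu eu) =
  monomial chi bm em * monomial chi bl el * monomial chi bu eu.

Lemma Lam1 : Lam 1 = 1.
Proof.
have mon0 (A : pzSemiRingType) (f : V -> A) b : monomial f b (fun=> 0%N) = 1.
  by rewrite monomialE /monomial_seq; elim: (index_iota _ _) => [|k s IH];
    rewrite ?big_nil.
by have := LamE (fun=> 0%N) (fun=> 0%N) (fun=> 0%N); rewrite !mon0 !mulr1.
Qed.

Lemma Lam_word_right em ys : {subset ys <= parab} ->
  Lam (monomial inc bm em * \prod_(y <- ys) inc y) =
  monomial chi bm em * \prod_(y <- ys) chi y.
Proof.
move=> ysp.
suff: Lam (monomial inc bm em * (\prod_(y <- ys) inc_chi y).1) =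
    monomial chi bm em * (\prod_(y <- ys) inc_chi y).2 by rewrite inc_chi_prod.
apply: (@lie_words_span _ _ br _ inc_chi (bl ++ bu) _ _
  (fun z : U * F^o => Lam (monomial inc bm em * z.1) =
                           monomial chi bm em * z.2)) => //.
- by move=> x y px py; case: (parab_br px py).
- by move=> x y px py; apply: inc_chi_br; case: (parab_br px py).
- split=> [|c x y /= xE yE]; first by rewrite !mulr0 linear0.
  by rewrite !mulrDr -scalerAr linearP xE yE -scalerAr.
- by move=> e; rewrite inc_chi_monomial !monomial_cat /= !mulrA LamE.
Qed.

Lemma Lam_word_left eu ys : {subset ys <= opp_parab} ->
  Lam ((\prod_(y <- ys) inc y) * monomial inc bu eu) =
  (\prod_(y <- ys) chi y) * monomial chi bu eu.
Proof.
move=> ysp.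
suff: Lam ((\prod_(y <- ys) inc_chi y).1 * monomial inc bu eu) =
    (\prod_(y <- ys) inc_chi y).2 * monomial chi bu eu by rewrite inc_chi_prod.
apply: (@lie_words_span _ _ br _ inc_chi (bm ++ bl) _ _
  (fun z : U * F^o => Lam (z.1 * monomial inc bu eu) =
                           z.2 * monomial chi bu eu)) => //.
- by move=> x y px py; case: (opp_parab_br px py).
- by move=> x y px py; apply: inc_chi_br; case: (opp_parab_br px py).
- split=> [|c x y /= xE yE]; first by rewrite !mul0r linear0.
  by rewrite !mulrDl -scalerAl linearP xE yE -scalerAl.
- by move=> e; rewrite inc_chi_monomial !monomial_cat /= LamE.
Qed.

(** The functional is equivariant for the parabolic subalgebra: straightening
    there takes place to the right of bm and preserves the character. *)
Lemma Lam_right u ys : {subset ys <= parab} ->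
  Lam (u * \prod_(y <- ys) inc y) = Lam u * \prod_(y <- ys) chi y.
Proof.
move=> ysp; move: u.
apply: (triangular_ind
  (P := fun u => Lam (u * \prod_(y <- ys) inc y) = Lam u * \prod_(y <- ys) chi y)).
  split=> [|c x y xE yE]; first by rewrite mul0r linear0 mul0r.
  by rewrite mulrDl -scalerAl !linearP xE yE mulrDl -scalerAl.
move=> em el eu; rewrite LamE -!mulrA.
rewrite [monomial inc bl el]monomialE [monomial inc bu eu]monomialE -!big_cat.
rewrite Lam_word_right; first by rewrite !big_cat -!monomialE.
move=> y; rewrite !mem_cat => /or3P[/monomial_seq_sub|/monomial_seq_sub|/ysp //] yb;
  by apply: memv_span; rewrite mem_cat yb ?orbT.
Qed.

Lemma Lam_left u ys : {subset ys <= opp_parab} ->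
  Lam ((\prod_(y <- ys) inc y) * u) = (\prod_(y <- ys) chi y) * Lam u.
Proof.
move=> ysp; move: u.
apply: (triangular_ind
  (P := fun u => Lam ((\prod_(y <- ys) inc y) * u) = (\prod_(y <- ys) chi y) * Lam u)).
  split=> [|c x y xE yE]; first by rewrite mulr0 linear0 mulr0.
  by rewrite mulrDr -scalerAr !linearP xE yE mulrDr -scalerAr.
move=> em el eu; rewrite LamE !mulrA.
rewrite [monomial inc bm em]monomialE [monomial inc bl el]monomialE -!big_cat.
rewrite Lam_word_left; first by rewrite !big_cat -!monomialE.
move=> y; rewrite !mem_cat -orbA => /or3P[/ysp //|/monomial_seq_sub|/monomial_seq_sub] yb;
  by apply: memv_span; rewrite mem_cat yb ?orbT.
Qed.

Variables (theta : V -> V) (T : {linear U -> U}).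
Hypothesis T_anti : anti_automorphism T.
Hypothesis TE : forall x, T (inc x) = inc (theta x).
Hypothesis chi_theta : forall x, chi (theta x) = chi x.
Hypothesis theta_parab : forall x, x \in opp_parab -> theta x \in parab.
Hypothesis theta_opp_parab : forall x, x \in parab -> theta x \in opp_parab.

Lemma T_word xs :
  T (\prod_(x <- xs) inc x) = \prod_(x <- rev (map theta xs)) inc x.
Proof.
have [_ T1 TM] := T_anti.
elim: xs => [|x xs IH]; first by rewrite !big_nil T1.
by rewrite big_cons TM IH TE /= rev_cons big_rcons.
Qed.

Lemma chi_word_theta xs :
  \prod_(x <- rev (map theta xs)) chi x = \prod_(x <- xs) chi x.
Proof.
rewrite (perm_big (map theta xs)); last by rewrite perm_rev.
by rewrite big_map; apply: eq_bigr.
Qed.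

Lemma T_involutive : involutive theta -> involutive T.
Proof.
move=> thetaK; apply: (triangular_ind (P := fun u => T (T u) = u)).
  by split=> [|c x y xE yE]; rewrite ?linear0 // !linearP xE yE.
move=> em el eu; rewrite !monomialE -!big_cat !T_word map_rev revK -map_comp.
by rewrite (eq_map (g := id)) ?map_id.
Qed.

(** The image of an ordered monomial is a word in the opposite subalgebra
    followed by a word in the parabolic one; both equivariances apply. *)
Lemma Lam_T u : Lam (T u) = Lam u.
Proof.
move: u; apply: (triangular_ind (P := fun u => Lam (T u) = Lam u)).
  by split=> [|c x y xE yE]; rewrite ?linear0 // !linearP xE yE.
have [_ _ TM] := T_anti; move=> em el eu; rewrite LamE !TM.
rewrite [monomial inc bm em]monomialE [monomial inc bl el]monomialE.
rewrite [monomial inc bu eu]monomialE mulrA -TM -big_cat.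
rewrite !T_word -[X in X * _]mulr1 Lam_right => [|y]; last first.
  rewrite mem_rev => /mapP[x /monomial_seq_sub bx ->].
  by apply/theta_parab/memv_span; rewrite mem_cat bx.
rewrite Lam_left => [|y]; last first.
  rewrite mem_rev => /mapP[x]; rewrite mem_cat => xlu ->.
  apply/theta_opp_parab/memv_span; rewrite mem_cat.
  by case/orP: xlu => /monomial_seq_sub ->; rewrite ?orbT.
by rewrite Lam1 mulr1 !chi_word_theta big_cat -!monomialE mulrC -mulrA.
Qed.

End Triangular.

(** * Root supports in truncated current algebras *)

Section TakiffSum.

Variables (F : fieldType) (g : vectType F) (r : nat).

Lemma epsE (i : 'I_r) (x : g) :
  eps g i x = [ffun j => if j == i then x else 0].
Proof.
rewrite linfunE // => c u v; apply/ffunP => j; rewrite !ffunE.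
by case: eqP => // _; rewrite scaler0 addr0.
Qed.

Lemma takiff_eps (X : takiff g r) : X = \sum_i eps g i (X i).
Proof.
apply/ffunP => j; rewrite sum_ffunE (bigD1 j) //= epsE ffunE eqxx big1 ?addr0 //.
by move=> i /negPf ij; rewrite epsE ffunE eq_sym ij.
Qed.

Lemma takiff_sumP (V : 'I_r -> {vspace g}) (X : takiff g r) :
  X \in takiff_sum V <-> forall i, X i \in V i.
Proof.
split=> [/memv_sumP[Y YV ->] j|XV].
  rewrite sum_ffunE; apply: memv_suml => i _.
  have /memv_imgP[x Vx ->] := YV i isT; rewrite epsE ffunE.
  by case: eqP => [->//|_]; apply: mem0v.
rewrite [X]takiff_eps; apply: memv_suml => i _.
by apply: subvP (memv_img _ (XV i)); apply: sumv_sup.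
Qed.

Lemma takiff_sumD (V W : 'I_r -> {vspace g}) :
  (takiff_sum V + takiff_sum W)%VS = takiff_sum (fun i => V i + W i)%VS.
Proof. by rewrite -big_split; apply: eq_bigr => i _; rewrite limgD. Qed.

End TakiffSum.

Section Supports.

Variables (F : numFieldType) (g : vectType F) (br : g -> g -> g).
Variables (t : {vspace g}) (Phi : seq 'Hom(subvs_of t, F^o)).
Hypotheses (g_lie : lie_bracket br) (t_cartan : cartan br t).
Hypothesis Phi_roots : root_enumeration br Phi.

Local Notation tdual := 'Hom(subvs_of t, F^o).
Local Notation n := (\dim {:g}).
Local Notation "''g_' a" := (root_space br a) (at level 8, a at level 2).

Variables (e : n.-tuple g) (wt : 'I_n -> tdual).
Hypothesis e_wt : weight_basis br e wt.

(** All the components of x in the root space decomposition have weight in Q;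
    in each degree, every summand of the triangular decomposition is the space
    of such vectors for some Q. *)
Definition supported (Q : {pred tdual}) (x : g) : Prop :=
  forall k, coord e k x != 0 -> wt k \in Q.

Lemma supported_linear Q : linear_pred (supported Q).
Proof.
split=> [k|c x y xQ yQ k]; first by rewrite linear0 eqxx.
rewrite linearD linearZ /=; have [->|/yQ//] := eqVneq (coord e k y) 0.
have [->|/xQ//] := eqVneq (coord e k x) 0.
by rewrite mulr0 addr0 eqxx.
Qed.

Lemma supportedW (Q Q' : {pred tdual}) x :
  (forall k, wt k \in Q -> wt k \in Q') -> supported Q x -> supported Q' x.
Proof. by move=> QQ' xQ k /xQ /QQ'. Qed.

Lemma supported_sum_in (Q : {pred tdual}) (P : g -> Prop) x : linear_pred P ->
  (forall k, wt k \in Q -> P e`_k) -> supported Q x -> P x.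
Proof.
move=> [P0 PD] Pe xQ; rewrite (coordE e_wt x).
elim: (index_enum _) => [|k s IH]; first by rewrite big_nil.
rewrite big_cons; have [->|/xQ/Pe Pk] := eqVneq (coord e k x) 0.
  by rewrite scale0r add0r.
exact: PD.
Qed.

Lemma supported_wt (k : 'I_n) (Q : {pred tdual}) : wt k \in Q -> supported Q e`_k.
Proof.
move=> Qk l; rewrite coord_free ?(basis_free e_wt.1) //.
by case: (eqVneq k l) => [<-|_] //; rewrite eqxx.
Qed.

Lemma supported_root_space (a : tdual) x :
  x \in 'g_a <-> supported (pred1 a) x.
Proof.
rewrite (root_space_coordP g_lie e_wt); split=> xa k /xa; first by move=> ->; rewrite inE.
by rewrite inE => /eqP.
Qed.

Lemma supported_t x : x \in t <-> supported (pred1 0) x.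
Proof. by rewrite -supported_root_space (root_space0 g_lie t_cartan). Qed.

Lemma supported_add (Q Q1 Q2 : {pred tdual}) (V W : {vspace g}) x :
  (forall y, y \in V <-> supported Q1 y) -> (forall y, y \in W <-> supported Q2 y) ->
  (forall k, wt k \in Q = (wt k \in Q1) || (wt k \in Q2)) ->
  x \in (V + W)%VS <-> supported Q x.
Proof.
move=> VQ WQ QE; split.
  move=> /memv_addP[v /VQ vQ [w /WQ wQ ->]]; rewrite -[v]scale1r.
  apply: (supported_linear Q).2.
    by apply: supportedW vQ => k Qk; rewrite QE Qk.
  by apply: supportedW wQ => k Qk; rewrite QE Qk orbT.
apply: (supported_sum_in (P := fun x => x \in (V + W)%VS)) => [|k].
  exact: memv_pred.
rewrite QE => /orP[] Qk.
  by apply: (subvP (addvSl _ _)); apply/VQ/supported_wt.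
by apply: (subvP (addvSr _ _)); apply/WQ/supported_wt.
Qed.

(** The map f is the identity, or the negation for the opposite nilradical. *)
Lemma supported_root_sum (f : tdual -> tdual) (P Q : {pred tdual}) x :
  (forall k, wt k \in Q <-> exists a, [/\ a \in Phi, a \in P & f a = wt k]) ->
  x \in (\sum_(a <- Phi | a \in P) 'g_(f a))%VS <-> supported Q x.
Proof.
move=> QE; split.
  rewrite big_seq_cond; elim/big_ind: _ x => [|V W IHV IHW|a /andP[Phi_a Pa]] x.
  - by rewrite memv0 => /eqP ->; apply: (supported_linear Q).1.
  - move=> /memv_addP[v /IHV vQ [w /IHW wQ ->]]; rewrite -[v]scale1r.
    exact: (supported_linear Q).2.
  - move/supported_root_space => xa k /xa; rewrite inE => /eqP kE.
    by apply/QE; exists a.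
apply: (supported_sum_in (P := fun x => x \in _)) => [|k /QE [a [Phi_a Pa ak]]].
  exact: memv_pred.
rewrite (big_rem a) //= Pa; apply: (subvP (addvSl _ _)).
by rewrite ak (root_space_wt g_lie e_wt).
Qed.

Lemma supported_br (Q Q1 Q2 : {pred tdual}) x y :
  (forall k l m, wt k \in Q1 -> wt l \in Q2 -> wt m = wt k + wt l -> wt m \in Q) ->
  supported Q1 x -> supported Q2 y -> supported Q (br x y).
Proof.
move=> Qadd xQ yQ; have [S0 SD] := supported_linear Q.
apply: (supported_sum_in (P := fun x => supported Q (br x y))) xQ => [|k Qk].
  by split=> [|c u v uQ vQ]; rewrite ?(br0l g_lie) ?(br_linearl g_lie) //; apply: SD.
apply: (supported_sum_in (P := fun y => supported Q (br e`_k y))) yQ => [|l Ql].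
  by split=> [|c u v uQ vQ]; rewrite ?(br0r g_lie) ?(br_linearr g_lie) //; apply: SD.
move=> m nz; apply: (Qadd k l m Qk Ql).
have := br_root_space g_lie (root_space_wt g_lie e_wt k) (root_space_wt g_lie e_wt l).
by move/(root_space_coordP g_lie e_wt); apply.
Qed.

Section Filtration.

Variables (r : nat) (psi : nat -> {pred tdual}).
Hypothesis psi_filt : parabolic_filtration Phi r psi.

Definition takiff_supported (Q : nat -> {pred tdual}) (X : takiff g r) : Prop :=
  forall i : 'I_r, supported (Q i) (X i).

Definition levi_supp i : {pred tdual} :=
  [pred b | (b == 0) || (b \in levi_factor psi i)].
Definition nil_plus_supp i : {pred tdual} :=
  [pred b | (b \in psi i) && (- b \notin psi i)].
Definition nil_minus_supp i : {pred tdual} :=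
  [pred b | (- b \in psi i) && (b \notin psi i)].
Definition parabolic_supp i : {pred tdual} := [pred b | (b == 0) || (b \in psi i)].
Definition opp_parabolic_supp i : {pred tdual} :=
  [pred b | (b == 0) || (- b \in psi i)].

Lemma psi_root i a : a \in psi i -> a \in Phi.
Proof. by have [par _ _] := psi_filt; have [sub _ _] := par i; apply: sub. Qed.

Lemma psi_cover i a : (a \in Phi) = (a \in psi i) || (- a \in psi i).
Proof. by have [par _ _] := psi_filt; have [_ _ cov] := par i; apply: cov. Qed.

Lemma psi_le i j : (i <= j)%N -> {subset psi i <= psi j}.
Proof.
have [_ inc _] := psi_filt => /subnK <-.
by elim: (j - i)%N => // k IH a /IH; rewrite addSn; apply: inc.
Qed.

Lemma psi_add i j a b : a \in psi i -> b \in psi j -> a + b \in Phi ->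
  a + b \in psi (i + j)%N.
Proof.
have [par _ _] := psi_filt; have [_ add _] := par (i + j)%N => ai bj.
by apply: add; [apply: psi_le ai; apply: leq_addr | apply: psi_le bj; apply: leq_addl].
Qed.

Lemma wt_cases k : wt k != 0 -> wt k \in Phi.
Proof. exact: (wt_root g_lie e_wt Phi_roots). Qed.

Lemma levi_componentP i x :
  x \in (t + \sum_(a <- Phi | a \in levi_factor psi i) 'g_a)%VS <->
  supported (levi_supp i) x.
Proof.
apply: (supported_add (Q1 := pred1 0) (Q2 := levi_factor psi i)) => //.
  exact: supported_t.
move=> y; apply: (supported_root_sum (f := id)) => k; split=> [kL|[a [_ aL <-]] //].
by exists (wt k); split=> //; have /andP[/psi_root] := kL.
Qed.

Lemma nil_plus_componentP i x :
  x \in (\sum_(a <- Phi | (a \in psi i) && (a \notin levi_factor psi i)) 'g_a)%VS <->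
  supported (nil_plus_supp i) x.
Proof.
have E a : (a \in psi i) && (a \notin levi_factor psi i) = (a \in nil_plus_supp i).
  by rewrite !inE; case: (a \in psi i).
rewrite (eq_bigl _ _ E).
apply: (supported_root_sum (f := id)) => k; split=> [kL|[a [_ aL <-]] //].
by exists (wt k); split=> //; have /andP[/psi_root] := kL.
Qed.

Lemma nil_minus_componentP i x :
  x \in (\sum_(a <- Phi | (a \in psi i) && (a \notin levi_factor psi i)) 'g_(- a))%VS
  <-> supported (nil_minus_supp i) x.
Proof.
have E a : (a \in psi i) && (a \notin levi_factor psi i) = (a \in nil_plus_supp i).
  by rewrite !inE; case: (a \in psi i).
rewrite (eq_bigl _ _ E).
apply: (supported_root_sum (f := -%R)) => k; split=> [kL|[a [_ aL <-]]].
  exists (- wt k); split; rewrite ?opprK // ?inE ?opprK //.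
  by have /andP[/psi_root] := kL.
by rewrite inE opprK.
Qed.

Lemma nil_plusP X : X \in nil_plus br r Phi psi <-> takiff_supported nil_plus_supp X.
Proof. by rewrite takiff_sumP; split=> H i; apply/nil_plus_componentP; apply: H. Qed.

Lemma nil_minusP X : X \in nil_minus br r Phi psi <-> takiff_supported nil_minus_supp X.
Proof. by rewrite takiff_sumP; split=> H i; apply/nil_minus_componentP; apply: H. Qed.

Lemma parabolicP X :
  X \in parabolic_alg br r Phi psi <-> takiff_supported parabolic_supp X.
Proof.
rewrite /parabolic_alg takiff_sumD takiff_sumP.
have H i x := supported_add (Q := parabolic_supp i) x
  (@levi_componentP i) (@nil_plus_componentP i).
split=> HX i; apply/H => // k; rewrite !inE -orbA; congr (_ || _);
  by case: (wt k \in psi i); rewrite //= orbN.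
Qed.

Lemma opp_parabolicP X : X \in (nil_minus br r Phi psi + levi br r Phi psi)%VS <->
  takiff_supported opp_parabolic_supp X.
Proof.
rewrite takiff_sumD takiff_sumP.
have H i x := supported_add (Q := opp_parabolic_supp i) x
  (@nil_minus_componentP i) (@levi_componentP i).
split=> HX i; apply/H => // k; rewrite !inE orbCA; congr (_ || _);
  by case: (wt k \in psi i); case: (- wt k \in psi i).
Qed.

Lemma triangular_full :
  (nil_minus br r Phi psi + levi br r Phi psi + nil_plus br r Phi psi = fullv)%VS.
Proof.
apply/vspaceP => X; rewrite memvf; apply/idP.
rewrite !takiff_sumD takiff_sumP => i.
apply/(supported_add (Q := predT) (Q1 := opp_parabolic_supp i)
  (Q2 := nil_plus_supp i)) => // [x|x|k].
- apply: supported_add; [exact: nil_minus_componentP|exact: levi_componentP|].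
  move=> k; rewrite !inE orbCA; congr (_ || _).
  by case: (wt k \in psi i); case: (- wt k \in psi i).
- exact: nil_plus_componentP.
rewrite !inE; have [//|/wt_cases] := eqVneq (wt k) 0.
by rewrite (psi_cover i); case: (- wt k \in psi i); rewrite //= orbF andbT.
Qed.

Lemma takiff_supported_br (Q : nat -> {pred tdual}) X Y :
  (forall i j k l m, wt k \in Q i -> wt l \in Q j -> wt m = wt k + wt l ->
     wt m \in Q (i + j)%N) ->
  takiff_supported Q X -> takiff_supported Q Y ->
  takiff_supported Q (takiff_br br X Y).
Proof.
move=> Qadd XQ YQ m; rewrite ffunE; have [S0 SD] := supported_linear (Q m).
have Ssum (I : finType) (P : pred I) (f : I -> g) :
    (forall i, P i -> supported (Q m) (f i)) -> supported (Q m) (\sum_(i | P i) f i).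
  move=> fQ; elim/big_ind: _ => // u v uQ vQ; rewrite -[u]scale1r; exact: SD.
apply: (Ssum) => i _; apply: (Ssum) => j /eqP <-.
by apply: supported_br (XQ i) (YQ j) => k l m'; apply: Qadd.
Qed.

Lemma parabolic_br X Y :
  X \in parabolic_alg br r Phi psi -> Y \in parabolic_alg br r Phi psi ->
  takiff_br br X Y \in parabolic_alg br r Phi psi.
Proof.
move=> /parabolicP PX /parabolicP PY; apply/parabolicP.
apply: takiff_supported_br PX PY => i j k l m.
rewrite !inE => /orP[/eqP->|ki]; rewrite ?add0r.
  case/orP=> [/eqP->|lj] ->; first by rewrite eqxx.
  by rewrite (psi_le _ lj) ?orbT ?leq_addl.
case/orP=> [/eqP->|lj] mE.
  by rewrite mE addr0 (psi_le _ ki) ?orbT ?leq_addr.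
have [//|/wt_cases] := eqVneq (wt m) 0.
by rewrite mE; apply: psi_add.
Qed.

Section Transposition.

Variable tau : {linear g -> g}.
Hypothesis tauK : involutive tau.
Hypothesis tau_br : forall x y, tau (br x y) = br (tau y) (tau x).
Hypothesis tau_t : forall h, h \in t -> tau h = h.

Lemma tau_root_space (a : tdual) x : x \in 'g_a -> tau x \in 'g_(- a).
Proof.
move=> /(root_spaceP g_lie) xa; apply/(root_spaceP g_lie) => h.
rewrite -{1}(tau_t (subvsP h)) -tau_br (brC g_lie) xa opp_lfunE /=.
by rewrite linearN linearZ scaleNr.
Qed.

Lemma tau_supported (Q Q' : {pred tdual}) x :
  (forall k, wt k \in Q -> - wt k \in Q') -> supported Q x ->
  supported Q' (tau x).
Proof.
move=> QQ'; have [S0 SD] := supported_linear Q'.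
apply: (supported_sum_in (P := fun x => supported Q' (tau x))) => [|k /QQ' Qk].
  by split=> [|c u v uQ vQ]; rewrite ?linear0 // linearP; apply: SD.
have /(root_space_coordP g_lie e_wt) tk :=
  tau_root_space (root_space_wt g_lie e_wt k).
by move=> l /tk ->.
Qed.

Local Notation theta := (@takiff_map F g r tau).

Lemma theta_involutive : involutive theta.
Proof. by move=> X; apply/ffunP => i; rewrite !ffunE tauK. Qed.

Lemma theta_br X Y : theta (takiff_br br X Y) = takiff_br br (theta Y) (theta X).
Proof.
apply/ffunP => k; rewrite !ffunE linear_sum.
under eq_bigr do rewrite linear_sum big_mkcond.
under [RHS]eq_bigr do rewrite big_mkcond.
rewrite exchange_big; apply: eq_bigr => i _; apply: eq_bigr => j _.
by rewrite addnC !ffunE; case: ifP => //; rewrite tau_br.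
Qed.

Lemma theta_parabolic X : X \in parabolic_alg br r Phi psi ->
  theta X \in (nil_minus br r Phi psi + levi br r Phi psi)%VS.
Proof.
move=> /parabolicP PX; apply/opp_parabolicP => i; rewrite ffunE.
by apply: tau_supported (PX i) => k; rewrite !inE oppr_eq0 opprK.
Qed.

Lemma theta_opp_parabolic X :
  X \in (nil_minus br r Phi psi + levi br r Phi psi)%VS ->
  theta X \in parabolic_alg br r Phi psi.
Proof.
move=> /opp_parabolicP PX; apply/parabolicP => i; rewrite ffunE.
by apply: tau_supported (PX i) => k; rewrite !inE oppr_eq0.
Qed.

Variable lam : 'I_r -> tdual.
Local Notation chi := (takiff_char br Phi lam).

Lemma cartan_part_linear : linear (cartan_part br Phi).
Proof. by move=> c x y; rewrite /cartan_part !linearP. Qed.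

Lemma takiff_char_linear : linear (chi : takiff g r -> F^o).
Proof.
move=> c X Y; rewrite /takiff_char scaler_sumr -big_split.
apply: eq_bigr => i _.
by rewrite !ffunE cartan_part_linear linearP.
Qed.

Lemma root_sumP x : x \in (\sum_(a <- Phi) 'g_a)%VS <-> supported (mem Phi) x.
Proof.
apply: (supported_root_sum (f := id) (P := predT)) => k.
by split=> [Phi_k|[a [Phi_a _ <-]] //]; exists (wt k).
Qed.

Lemma t_root_sum_cap : (t :&: \sum_(a <- Phi) 'g_a = 0)%VS.
Proof.
apply/eqP; rewrite -subv0; apply/subvP => x; rewrite memv_cap memv0.
move=> /andP[/supported_t xt /root_sumP xPhi]; apply/eqP.
apply: (coord_inj e_wt) => k; rewrite linear0.
have [//|nz] := eqVneq (coord e k x) 0.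
have := root_neq0 Phi_roots (xPhi k nz).
by have := xt k nz; rewrite inE => ->.
Qed.

Lemma cartan_part_nonzero x : supported (predC1 0) x -> cartan_part br Phi x = 0.
Proof.
move=> xs; have xPhi : x \in (\sum_(a <- Phi) 'g_a)%VS.
  by apply/root_sumP; apply: supportedW xs => k; rewrite inE => /wt_cases.
rewrite /cartan_part; set W := (\sum_(a <- Phi) _)%VS in xPhi *.
have := daddv_pi_add t_root_sum_cap (subvP (addvSr t W) _ xPhi).
rewrite [X in _ + X](daddv_pi_id _ xPhi) 1?capvC ?t_root_sum_cap //.
by move/eqP; rewrite -subr_eq0 addrK => /eqP ->; rewrite linear0.
Qed.

Lemma cartan_part_tau x : cartan_part br Phi (tau x) = cartan_part br Phi x.
Proof.
have cp0 : cartan_part br Phi 0 = 0 by rewrite /cartan_part !linear0.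
have xs : supported predT x by [].
apply: (supported_sum_in
  (P := fun x => cartan_part br Phi (tau x) = cartan_part br Phi x)) xs => [|k _].
  by split=> [|c u v uE vE]; rewrite ?linear0 // linearP !cartan_part_linear uE vE.
have [k0|k0] := eqVneq (wt k) 0.
  by rewrite tau_t //; apply/supported_t/supported_wt; rewrite inE k0.
rewrite !cartan_part_nonzero //; first exact: supported_wt.
apply: (tau_supported (Q := pred1 (wt k))) => [l|]; last first.
  by apply: supported_wt; rewrite inE.
by rewrite !inE => /eqP ->; rewrite oppr_eq0.
Qed.

Lemma takiff_char_theta X : chi (theta X) = chi X.
Proof. by apply: eq_bigr => i _; rewrite ffunE cartan_part_tau. Qed.

Lemma takiff_char_eq0 X : takiff_supported (fun=> predC1 0) X -> chi X = 0.
Proof.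
by move=> Xs; rewrite /takiff_char big1 // => i _; rewrite cartan_part_nonzero ?linear0.
Qed.

Lemma zero_notin_psi i : 0 \notin psi i.
Proof. by apply/negP => /psi_root /(root_neq0 Phi_roots); rewrite eqxx. Qed.

Lemma takiff_char_nil_plus X : X \in nil_plus br r Phi psi -> chi X = 0.
Proof.
move=> /nil_plusP Xs; apply: takiff_char_eq0 => i.
apply: supportedW (Xs i) => k; rewrite !inE => /andP[ki _].
by apply: contraTneq ki => ->; apply: zero_notin_psi.
Qed.

Lemma takiff_char_nil_minus X : X \in nil_minus br r Phi psi -> chi X = 0.
Proof.
move=> /nil_minusP Xs; apply: takiff_char_eq0 => i.
apply: supportedW (Xs i) => k; rewrite !inE => /andP[ki _].
by apply: contraTneq ki => ->; rewrite oppr0; apply: zero_notin_psi.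
Qed.

(** The opposite parabolic subalgebra is the transpose of the parabolic one. *)
Lemma opp_parabolic_br X Y :
  (forall X Y, X \in parabolic_alg br r Phi psi ->
     Y \in parabolic_alg br r Phi psi -> chi (takiff_br br X Y) = 0) ->
  X \in (nil_minus br r Phi psi + levi br r Phi psi)%VS ->
  Y \in (nil_minus br r Phi psi + levi br r Phi psi)%VS ->
  takiff_br br X Y \in (nil_minus br r Phi psi + levi br r Phi psi)%VS /\
  chi (takiff_br br X Y) = 0.
Proof.
move=> chi0 /theta_opp_parabolic pX /theta_opp_parabolic pY.
rewrite -(theta_involutive (takiff_br br X Y)) theta_br; split.
  by apply: theta_parabolic; apply: parabolic_br.
by rewrite takiff_char_theta chi0.
Qed.

End Transposition.

End Filtration.

End Supports.

(** * The radical of the Shapovalov form *)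

Section DoubleCommutant.

Variables (U : pzRingType) (S : U -> Prop).
Hypothesis S_comm : forall x y, S x -> S y -> x * y = y * x.

(** A commutative family generates a commutative algebra; the double commutant
    has this property without a description of its elements by words. *)
Definition double_commutant (z : U) : Prop :=
  forall v, (forall x, S x -> v * x = x * v) -> v * z = z * v.

Lemma double_commutant_comm x y :
  double_commutant x -> double_commutant y -> x * y = y * x.
Proof.
move=> Dx Dy; apply: Dy => z Sz; apply/esym; apply: Dx => u Su.
exact: S_comm.
Qed.

Lemma double_commutant1 : double_commutant 1.
Proof. by move=> v _; rewrite mulr1 mul1r. Qed.

Lemma double_commutantM x y :
  double_commutant x -> double_commutant y -> double_commutant (x * y).
Proof. by move=> Dx Dy v Sv; rewrite mulrA (Dx v Sv) -!mulrA (Dy v Sv). Qed.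

End DoubleCommutant.

Section CyclicForm.

Variables (F : fieldType) (U : algType F) (M : lmodType U) (w : M).
Hypothesis w_gen : forall x : M, exists u, x = u *: w.
Variables (Lam : {linear U -> F^o}) (L : {additive M -> F^o}).
Hypothesis LE : forall u, L (u *: w) = Lam u.
Hypothesis Lam1 : Lam 1 = 1.

Lemma L_scale c x : L (c%:A *: x) = c * L x.
Proof.
have [u ->] := w_gen x; rewrite scalerA !LE.
by rewrite -scalerAl mul1r linearZ.
Qed.

Definition form_radical : set M := [set x | forall u : U, L (u *: x) = 0].

Lemma form_radical_proper : proper_submodule form_radical.
Proof.
split; first split=> [u|x y Rx Ry u|v x Rx u].
- by rewrite scaler0 raddf0.
- by rewrite scalerDr raddfD Rx Ry addr0.
- by rewrite scalerA.
apply/eqP => /seteqP[_ /(_ w I)] /= /(_ 1).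
by rewrite LE Lam1 => /eqP; rewrite oner_eq0.
Qed.

(** A submodule that contains x with L x nonzero also contains the component
    (L x) w of x, hence the generator w, and is not proper. *)
Lemma sum_proper_form_radical :
  (forall x, exists z : U, z *: x = (L x)%:A *: w) ->
  sum_proper_submodules M = form_radical.
Proof.
move=> proj; apply/seteqP; split=> [_ [n [K [y [KP ->]]]] u|x Rx]; last first.
  exists 1%N, (fun=> form_radical), (fun=> x); split; last by rewrite big_ord1.
  by split=> //; apply: form_radical_proper.
rewrite scaler_sumr raddf_sum big1 // => k _.
have [[[K0 KD KZ] properK] Ky] := KP k.
have /KZ := Ky => /(_ u); set v := u *: y k => Kv.
apply: contrapT => /eqP Lv; case/eqP: properK; apply/seteqP; split=> // x _.
have [z zv] := proj v.
have Kw : K k w.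
  have := KZ ((L v)^-1%:A * z) v Kv; rewrite -scalerA zv scalerA.
  by rewrite -scalerAl mul1r scalerA mulVf // scale1r scale1r.
by have [u' ->] := w_gen x; apply: KZ.
Qed.

Variables (T : {linear U -> U}).
Hypotheses (T_anti : anti_automorphism T) (TK : involutive T).
Hypothesis Lam_T : forall u, Lam (T u) = Lam u.

(** Symmetry gives S(x, u w) = L((T u) x), which does not involve the chosen
    representatives, and T u runs through all of U. *)
Lemma radical_form_radical (S : M -> M -> F) :
  (forall x y, S x y = Lam (T (representative w x) * representative w y)) ->
  radical S = form_radical.
Proof.
move=> SE; have [T_bij T1 TM] := T_anti.
have repE x : representative w x *: w = x.
  by have [u xE] := w_gen x; apply: (@xgetPex _ 0 [set X | X *: w = x]); exists u.
have SL x u : S x (u *: w) = L (T u *: x).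
  rewrite SE -LE -scalerA repE scalerA LE -Lam_T TM TK -LE -scalerA.
  by rewrite repE.
apply/seteqP; split=> x Rx u.
  by rewrite -[u]TK -SL; apply: Rx.
by have [v ->] := w_gen u; rewrite SL; apply: Rx.
Qed.

End CyclicForm.

Section ShapovalovRadical.

Variables (F : numFieldType) (g : vectType F) (br : g -> g -> g).
Variables (t : {vspace g}) (Phi : seq 'Hom(subvs_of t, F^o)).
Hypotheses (g_lie : lie_bracket br) (g_red : reductive br) (t_cartan : cartan br t).
Hypothesis Phi_roots : root_enumeration br Phi.

Local Notation tdual := 'Hom(subvs_of t, F^o).

Variable tau : {linear g -> g}.
Hypothesis tauK : involutive tau.
Hypothesis tau_br : forall x y, tau (br x y) = br (tau y) (tau x).
Hypothesis tau_t : forall h, h \in t -> tau h = h.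

Variables (r : nat) (psi : nat -> {pred tdual}) (lam : 'I_r -> tdual).
Hypotheses (r_gt0 : (0 < r)%N) (psi_filt : parabolic_filtration Phi r psi).

Local Notation p := (parabolic_alg br r Phi psi).
Local Notation l := (levi br r Phi psi).
Local Notation um := (nil_minus br r Phi psi).
Local Notation up := (nil_plus br r Phi psi).
Local Notation brr := (takiff_br br (r:=r)).

Definition takiff_chi (X : takiff g r) : F^o := takiff_char br Phi lam X.
HB.instance Definition _ := GRing.isLinear.Build F (takiff g r) F^o _
  takiff_chi (takiff_char_linear br Phi lam).

Variables (U Up Ul : algType F) (inc : {linear takiff g r -> U}).
Variables (incp : {linear subvs_of p -> Up}) (incl : {linear subvs_of l -> Ul}).
Hypotheses (U_env : enveloping brr inc) (Up_env : enveloping (@sub_br _ _ brr p) incp).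
Variables (chip : {lrmorphism Up -> F^o}) (chil : {lrmorphism Ul -> F^o}).
Hypothesis chipE : forall X, chip (incp X) = takiff_chi (vsval X).
Hypothesis chilE : forall X, chil (incl X) = takiff_chi (vsval X).
Variables (j : {lrmorphism Up -> U}).
Hypothesis jE : forall X, j (incp X) = inc (vsval X).
Variables (M : lmodType U) (ten : U -> F -> M).
Hypothesis M_ind : induced_module j chip ten.
Variables (T : {linear U -> U}).
Hypotheses (T_anti : anti_automorphism T).
Hypothesis TE : forall X, T (inc X) = inc (takiff_map tau X).
Variables (bm bu : seq (takiff g r)) (bl : seq (subvs_of l)).
Hypotheses (bm_basis : basis_of um bm) (bl_basis : basis_of fullv bl).
Hypothesis bu_basis : basis_of up bu.
Variable pi : {linear U -> Ul}.
Hypothesis pi_proj : pbw_projection inc incl bm bl bu pi.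

Let w := ten 1 1.
Let bl' := map vsval bl.

(** The character chip is multiplicative with commutative values. *)
Lemma parabolic_char_br X Y : X \in p -> Y \in p -> takiff_chi (brr X Y) = 0.
Proof.
have [e [wt e_wt]] := weight_basis_exists g_lie t_cartan.
move=> pX pY.
have pXY : brr X Y \in p.
  exact: (parabolic_br g_lie t_cartan Phi_roots e_wt psi_filt pX pY).
rewrite -(vsprojK pXY) -chipE.
have -> : vsproj p (brr X Y) = sub_br brr (vsproj p X) (vsproj p Y).
  by rewrite /sub_br !vsprojK.
by rewrite Up_env.1 rmorphB !rmorphM /= mulrC subrr.
Qed.

Lemma span_bl' : <<bl'>>%VS = l.
Proof.
apply/eqP; rewrite eqEsubv; apply/andP; split.
  by apply/span_subvP => _ /mapP[x _ ->]; apply: subvsP.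
apply/subvP => X lX; rewrite -(vsprojK lX).
have := memvf (vsproj l X); rewrite -(span_basis bl_basis).
apply: (span_pred (P := fun x => vsval x \in <<bl'>>%VS)).
  by split=> [|c x y Hx Hy]; rewrite ?linear0 ?mem0v // linearP memvD ?memvZ.
by move=> x blx; apply: memv_span; apply: map_f.
Qed.

Lemma span_bm : <<bm>>%VS = um. Proof. exact: span_basis. Qed.
Lemma span_bu : <<bu>>%VS = up. Proof. exact: span_basis. Qed.

Lemma span_parab : <<bl' ++ bu>>%VS = p.
Proof. by rewrite span_cat span_bl' span_bu. Qed.

Lemma span_opp_parab : <<bm ++ bl'>>%VS = (um + l)%VS.
Proof. by rewrite span_cat span_bl' span_bm. Qed.

Lemma triangular_bases : (<<bm>> + <<bl'>> + <<bu>>)%VS = fullv.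
Proof.
have [e [wt e_wt]] := weight_basis_exists g_lie t_cartan.
rewrite span_bl' span_bm span_bu.
exact: (triangular_full g_lie t_cartan Phi_roots e_wt psi_filt).
Qed.

Lemma parab_br X Y : X \in <<bl' ++ bu>>%VS -> Y \in <<bl' ++ bu>>%VS ->
  brr X Y \in <<bl' ++ bu>>%VS /\ takiff_chi (brr X Y) = 0.
Proof.
have [e [wt e_wt]] := weight_basis_exists g_lie t_cartan.
rewrite span_parab => pX pY; split; last exact: parabolic_char_br.
exact: (parabolic_br g_lie t_cartan Phi_roots e_wt psi_filt pX pY).
Qed.

Lemma opp_parab_br X Y : X \in <<bm ++ bl'>>%VS -> Y \in <<bm ++ bl'>>%VS ->
  brr X Y \in <<bm ++ bl'>>%VS /\ takiff_chi (brr X Y) = 0.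
Proof.
have [e [wt e_wt]] := weight_basis_exists g_lie t_cartan.
rewrite span_opp_parab.
apply: (opp_parabolic_br g_lie t_cartan Phi_roots e_wt psi_filt tauK tau_br tau_t).
exact: parabolic_char_br.
Qed.

Lemma chi_nil_plus X : X \in up -> takiff_chi X = 0.
Proof.
have [e [wt e_wt]] := weight_basis_exists g_lie t_cartan.
exact: (takiff_char_nil_plus g_lie t_cartan Phi_roots e_wt psi_filt).
Qed.

Lemma chi_nil_minus X : X \in um -> takiff_chi X = 0.
Proof.
have [e [wt e_wt]] := weight_basis_exists g_lie t_cartan.
exact: (takiff_char_nil_minus g_lie t_cartan Phi_roots e_wt psi_filt).
Qed.

Definition Lam (u : U) : F^o := chil (pi u).

Fact Lam_linear : linear Lam.
Proof. by move=> c x y; rewrite /Lam !linearP. Qed.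

HB.instance Definition _ := GRing.isLinear.Build F U F^o _ Lam Lam_linear.

Lemma pbw_monomialE (V : vectType F) (A : algType F) (f : V -> A) (b : seq V) e :
  pbw_monomial f (fun k : 'I_(size b) => e (nat_of_ord k)) = monomial f b e.
Proof. by rewrite /monomial big_mkord. Qed.

Lemma monomial_chi0 (b : seq (takiff g r)) e :
  (forall X, X \in b -> takiff_chi X = 0) ->
  monomial takiff_chi b e = [forall k : 'I_(size b), e (nat_of_ord k) == 0%N]%:R.
Proof.
move=> b0; rewrite /monomial big_mkord; case: forallP => [e0|].
  by rewrite big1 // => k _; rewrite (eqP (e0 k)) expr0.
move=> /existsNP[k /negP ek]; rewrite (bigD1 k) //= b0 ?mem_nth //.
by rewrite expr0n (negPf ek) mul0r.
Qed.

(** On monomials with a factor in bm or bu both sides vanish; on the others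
    chil is multiplicative. *)
Lemma LamE em el eu :
  Lam (monomial inc bm em * monomial inc bl' el * monomial inc bu eu) =
  monomial takiff_chi bm em * monomial takiff_chi bl' el * monomial takiff_chi bu eu.
Proof.
have blE (A : algType F) (f : takiff g r -> A) :
    monomial f bl' el = monomial (fun x => f (vsval x)) bl el.
  rewrite /monomial size_map; apply: eq_big_nat => k /andP[_ kb].
  by rewrite (nth_map 0).
rewrite /Lam -[monomial inc bm em]pbw_monomialE -[monomial inc bu eu]pbw_monomialE.
rewrite (blE U) -pbw_monomialE pi_proj.
rewrite (@monomial_chi0 bm) => [|X /memv_span]; last first.
  by rewrite span_bm; apply: chi_nil_minus.
rewrite (@monomial_chi0 bu) => [|X /memv_span]; last first.
  by rewrite span_bu; apply: chi_nil_plus.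
case: ifP => [/andP[-> ->]|]; last first.
  rewrite linear0; case: [forall _, _] => /= [->|_]; last by rewrite !mul0r.
  by rewrite mulr0.
rewrite mulr1 mul1r (blE F^o) rmorph_prod /monomial big_mkord.
by apply: eq_bigr => k _; rewrite rmorphXn /= chilE.
Qed.

Let Lam_one : Lam 1 = 1 := Lam1 LamE.

Lemma Lam_j u q : Lam (u * j q) = Lam u * chip q.
Proof.
have := @enveloping_words _ _ _ _ _ Up_env q.
move/(_ (fun q => Lam (u * j q) = Lam u * chip q)); apply=> [|xs].
  split=> [|c x y xE yE]; first by rewrite !linear0 mulr0 linear0 mulr0.
  by rewrite [j _]linearP [chip _]linearP /= !mulrDr -!scalerAr [Lam _]linearP /= xE yE.
rewrite !rmorph_prod /=.
under eq_bigr do rewrite jE.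
rewrite -(big_map vsval xpredT inc) (Lam_right U_env triangular_bases parab_br LamE).
  by rewrite big_map; congr (_ * _); apply: eq_bigr => x _; rewrite chipE.
by rewrite span_parab => _ /mapP[x _ ->]; apply: subvsP.
Qed.

(** Equivariance of Lam for the parabolic subalgebra makes it balanced. *)
Lemma ten_functional : exists L : {additive M -> F^o}, forall u, L (u *: w) = Lam u.
Proof.
have bal : balanced j chip (fun (u : U) c => Lam u * c : F^o).
  split=> [u v c|u c d|u q c].
  - by rewrite linearD mulrDl.
  - by rewrite mulrDr.
  - by rewrite Lam_j mulrA.
have [_ tenM /(_ _ _ bal) [L LE _]] := M_ind.
by exists L => u; rewrite /w -tenM mulr1 LE mulr1.
Qed.

Lemma parab_word_w xs : {subset xs <= p} ->
  (\prod_(x <- xs) inc x) *: w = (\prod_(x <- xs) takiff_chi x)%:A *: w.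
Proof.
move=> xsp.
have -> : \prod_(x <- xs) inc x = j (\prod_(x <- xs) incp (vsproj p x)).
  rewrite rmorph_prod; apply: eq_big_seq => x /xsp px.
  by rewrite /= jE vsprojK.
rewrite (ten_restrict M_ind) rmorph_prod; congr (_ %:A *: _).
by apply: eq_big_seq => x /xsp px; rewrite /= chipE vsprojK.
Qed.

Section HighestWeight.

Variable L : {additive M -> F^o}.
Hypothesis LE : forall u, L (u *: w) = Lam u.

(* the weights are those of t in degree zero *)
Let i0 : 'I_r := Ordinal r_gt0.
Let teps (h : subvs_of t) : takiff g r := eps g i0 (vsval h).

Lemma teps_br h X : brr (teps h) X = takiff_map (br (vsval h)) X.
Proof.
apply/ffunP => k; rewrite !ffunE (bigD1 i0) //= [X in _ + X]big1 ?addr0.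
  by rewrite (big_pred1 k) // /teps epsE ffunE eqxx.
move=> i /negPf i0i; rewrite big1 // => m _.
by rewrite /teps epsE ffunE i0i br0l.
Qed.

Lemma teps_p h : teps h \in p.
Proof.
have [e [wt e_wt]] := weight_basis_exists g_lie t_cartan.
apply/(parabolicP g_lie t_cartan e_wt psi_filt) => i k.
rewrite /teps epsE ffunE; case: ifP => _; last by rewrite linear0 eqxx.
have /(supported_t g_lie t_cartan e_wt) := subvsP h.
by move=> /(_ k) hk /hk; rewrite !inE => ->.
Qed.

Lemma teps_comm x y : (exists h, x = inc (teps h)) -> (exists h, y = inc (teps h)) ->
  x * y = y * x.
Proof.
move=> [h ->] [h' ->]; apply/eqP; rewrite -subr_eq0 -U_env.1 teps_br.
suff -> : takiff_map (br (vsval h)) (teps h') = 0 by rewrite linear0.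
apply/ffunP => k; rewrite ffunE /teps epsE !ffunE.
case: ifP => _; last exact: br0r.
by apply: (t_abelian t_cartan); apply: subvsP.
Qed.

Local Notation torus := (double_commutant (fun x => exists h, x = inc (teps h))).

(** The inclusion of psi_0 in psi_i puts all the weights that occur in the
    opposite of the nilradical of the single parabolic set psi_0. *)
Lemma nil_minus_weight_vectors : exists hm : seq (takiff g r),
  <<hm>>%VS = um /\
  forall X, X \in hm -> exists2 b : tdual, (- b \in psi 0%N) && (b \notin psi 0%N) &
    forall h, brr (teps h) X = (b h : F) *: X.
Proof.
have [e [wt e_wt]] := weight_basis_exists g_lie t_cartan.
pose idx : seq ('I_r * 'I_(\dim {:g})) :=
  filter (fun ik : 'I_r * 'I_(\dim {:g}) => wt ik.2 \in nil_minus_supp psi ik.1)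
    (enum predT).
pose hm := map (fun ik : 'I_r * 'I_(\dim {:g}) => eps g ik.1 e`_ik.2) idx.
have memP := nil_minusP g_lie e_wt psi_filt.
exists hm; split.
  apply/eqP; rewrite eqEsubv; apply/andP; split.
    apply/span_subvP => _ /mapP[[i k] + ->].
    rewrite mem_filter => /andP[/= ik _]; apply/memP => i' k'.
    rewrite epsE ffunE; case: ifP => [/eqP ->|_]; last by rewrite linear0 eqxx.
    exact: (supported_wt e_wt ik).
  apply/subvP => X /memP Xs; rewrite [X]takiff_eps; apply: memv_suml => i _.
  rewrite [X i](coordE e_wt) linear_sum; apply: memv_suml => k _.
  rewrite linearZ /=; have [->|/(Xs i) ik] := eqVneq (coord e k (X i)) 0.
    by rewrite scale0r mem0v.
  rewrite memvZ // memv_span //; apply/mapP; exists (i, k) => //.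
  by rewrite mem_filter ik mem_enum.
move=> _ /mapP[[i k] + ->]; rewrite mem_filter inE => /andP[/andP[/= nk k'] _].
exists (wt k).
  have k'0 : wt k \notin psi 0%N.
    by apply: contra k'; apply: (psi_le psi_filt); apply: leq0n.
  have := psi_root psi_filt nk; rewrite (psi_cover psi_filt 0%N) opprK.
  by rewrite (negPf k'0) orbF => ->.
move=> h; rewrite teps_br; apply/ffunP => i'; rewrite !ffunE epsE ffunE.
case: ifP => _; last by rewrite br0r // scaler0.
exact: (br_weight e_wt).
Qed.

(** Every vector is sent to its highest weight component by some element of
    the commutative algebra generated by t that fixes the generator: a vector
    of weight mu different from that of the generator is killed by
    (h - mu(h)) / (lam(h) - mu(h)) for a suitable h. *)
Lemma highest_weight_projector x : exists z : U, z *: x = (L x)%:A *: w.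
Proof.
have [hm [span_hm hm_wt]] := nil_minus_weight_vectors.
have scaleA c (y : U) v : y *: (c%:A *: v) = c%:A *: (y *: v) :> M.
  by rewrite !scalerA mulr_algr mulr_algl.
have scaleAl c (y : U) (v : M) : (c *: y) *: v = c%:A *: (y *: v).
  by rewrite scalerA mulr_algl.
(* in the double commutant of t, the projectors of two vectors commute, and
   their product serves for the sum *)
pose G (u : U) := exists z : U,
  [/\ torus z, z *: w = w & z *: (u *: w) = (Lam u)%:A *: w].
suff Gu u : G u.
  have [u ->] := induced_cyclic M_ind x; have [z [_ _ zE]] := Gu u.
  by exists z; rewrite -/w LE.
have G_lin : linear_pred G.
  split=> [|c a b [z1 [Z1 w1 E1]] [z2 [Z2 w2 E2]]].
    exists 1; split; [exact: double_commutant1 | by rewrite scale1r|].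
    by rewrite linear0 !scale0r scaler0.
  exists (z1 * z2); split; first exact: double_commutantM.
    by rewrite -scalerA w2.
  rewrite scalerDl scalerDr linearP /= scalerDl scalerDl; congr (_ + _).
    rewrite (double_commutant_comm teps_comm Z1 Z2) scaleAl scaleA -scalerA E1.
    by rewrite scaleA w2 scalerA -scalerAl mul1r scalerA.
  by rewrite -scalerA E2 scaleA w1.
have hm_um X : X \in hm -> X \in um by move=> hmX; rewrite -span_hm memv_span.
have teps_w h : inc (teps h) *: w = (takiff_chi (teps h))%:A *: w.
  have := parab_word_w (xs := [:: teps h]); rewrite !big_seq1; apply=> X.
  by rewrite inE => /eqP ->; apply: teps_p.
have Gword xs : {subset xs <= hm} -> G (\prod_(X <- xs) inc X).
  move=> xs_hm.
  (* s lists the weights of the letters *)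
  have [s [sz_s s_nil s_wt]] : exists s : seq tdual, [/\ size s = size xs,
      forall b, b \in s -> (- b \in psi 0%N) && (b \notin psi 0%N) &
      forall h, inc (teps h) * \prod_(X <- xs) inc X =
        (\prod_(X <- xs) inc X) * inc (teps h) +
        ((\sum_(b <- s) b) h : F) *: \prod_(X <- xs) inc X].
    elim: xs xs_hm => [|X xs IH] xs_hm.
      exists [::]; split=> // h.
      by rewrite !big_nil mulr1 mul1r lfunE scale0r addr0.
    have [Y xsY|s [sz_s s_nil s_wt]] := IH; first by apply: xs_hm; rewrite inE xsY orbT.
    have [b b_nil bE] := hm_wt X (xs_hm X (mem_head _ _)).
    exists (b :: s); split=> [|c|h]; first by rewrite /= sz_s.
      by rewrite inE => /predU1P[->//|/s_nil].
    have : inc (teps h) * inc X = inc X * inc (teps h) + (b h : F) *: inc X.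
      by rewrite -linearZ -bE U_env.1 addrC subrK.
    rewrite !big_cons add_lfunE mulrA => ->; rewrite mulrDl -mulrA s_wt mulrDr.
    by rewrite -scalerAr -scalerAl scalerDl addrAC -!addrA mulrA.
  case: xs => [|X xs] in xs_hm sz_s s_wt *.
    exists 1; split; [exact: double_commutant1 | by rewrite scale1r|].
    by rewrite big_nil Lam_one !scale1r.
  set m := \prod_(X <- _) _ in s_wt *.
  have sum_s : \sum_(b <- s) b != 0.
    rewrite -oppr_eq0 -sumrN -(big_map -%R xpredT id).
    have [par _ _] := psi_filt.
    apply: (nilradical_sum_neq0 g_lie t_cartan Phi_roots g_red (par 0%N)).
      by move=> _ /mapP[b /s_nil bs ->]; rewrite opprK.
    by case: (s) sz_s.
  have [h sh] : exists h, ((\sum_(b <- s) b) h : F) != 0.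
    apply: contrapT => noh; case/eqP: sum_s; apply/lfunP => h; rewrite lfunE /=.
    by apply: contrapT => /eqP ch; apply: noh; exists h.
  pose d : F := (\sum_(b <- s) b) h; pose c : F := takiff_chi (teps h).
  (* c and c + d are the eigenvalues of h on w and on m w *)
  exists ((- d)^-1 *: (inc (teps h) - (c + d)%:A)).
  have Lm0 : Lam m = 0.
    rewrite -[m]mulr1 (Lam_left U_env triangular_bases opp_parab_br LamE).
      rewrite big_cons /= chi_nil_minus ?mul0r //.
      by apply: hm_um; apply: xs_hm; apply: mem_head.
    move=> Y /xs_hm /hm_um; rewrite span_opp_parab.
    by apply: subvP; apply: addvSl.
  split.
  - move=> v Sv; rewrite -scalerAl -scalerAr mulrBl mulrBr mulr_algl mulr_algr.
    by rewrite Sv //; exists h.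
  - rewrite scaleAl scalerBl teps_w -/c -scalerBl -scalerBl opprD addrA subrr add0r.
    by rewrite scalerA -scalerAl mul1r scalerA mulVf ?oppr_eq0 // !scale1r.
  rewrite Lm0 !scale0r scaleAl scalerBl scalerA s_wt scalerDl -scalerA teps_w -/c -/d.
  rewrite scaleA (scaleAl d m) -scalerDl -scalerBl [(c + d)%:A]scalerDl subrr.
  by rewrite scale0r scaler0.
move: u; apply: (triangular_ind U_env (bm := hm) (bl := bl') (bu := bu)) => //.
  by rewrite span_hm -span_bm triangular_bases.
move=> em el eu; set v := monomial inc bl' el * monomial inc bu eu.
(* factors in the parabolic subalgebra act on w by scalars *)
have [c vw] : exists c : F, v *: w = c%:A *: w.
  rewrite /v !monomialE -big_cat parab_word_w; first by eexists.
  move=> X; rewrite mem_cat -span_parab span_cat => /orP[] /monomial_seq_sub bX.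
    by apply: (subvP (addvSl _ _)); apply: memv_span.
  by apply: (subvP (addvSr _ _)); apply: memv_span.
rewrite -mulrA -/v monomialE; set m := \prod_(X <- _) _; clearbody v.
have [|z [Zz zw zE]] := Gword (monomial_seq hm em).
  by move=> X /monomial_seq_sub.
exists z; split=> //; rewrite -LE -!scalerA vw !scaleA zE.
rewrite (L_scale (induced_cyclic M_ind) LE) LE.
by rewrite scalerA -scalerAl mul1r scalerA.
Qed.

End HighestWeight.

Lemma shapovalov_radical :
  sum_proper_submodules M = radical (shapovalov_mod T pi chil w).
Proof.
have [e [wt e_wt]] := weight_basis_exists g_lie t_cartan.
have [L LE] := ten_functional.
have w_gen := induced_cyclic M_ind.
have TK : involutive T.
  apply: (T_involutive U_env triangular_bases T_anti TE).
  exact: theta_involutive.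
have Lam_T u : Lam (T u) = Lam u.
  apply: (Lam_T U_env triangular_bases parab_br opp_parab_br LamE T_anti TE).
  - exact: (takiff_char_theta g_lie t_cartan Phi_roots e_wt tau_br tau_t lam).
  - rewrite span_parab span_opp_parab.
    exact: (theta_opp_parabolic g_lie t_cartan e_wt psi_filt tau_br tau_t).
  - rewrite span_parab span_opp_parab.
    exact: (theta_parabolic g_lie t_cartan e_wt psi_filt tau_br tau_t).
rewrite (radical_form_radical w_gen LE T_anti TK Lam_T); last by [].
apply: (sum_proper_form_radical w_gen LE Lam_one) => x.
exact: (highest_weight_projector LE).
Qed.

End ShapovalovRadical.

Theorem theorem15p1p11 (R : realType)
  (* the reductive Lie algebra, its Cartan subalgebra and its roots *)
  (g : vectType R[i]) (br : g -> g -> g) (t : {vspace g})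
  (Phi : seq 'Hom(subvs_of t, R[i]^o))
  (g_lie : lie_bracket br) (g_red : reductive br) (t_cartan : cartan br t)
  (Phi_roots : root_enumeration br Phi)
  (* simple roots, root vectors and transposition *)
  (Delta : seq 'Hom(subvs_of t, R[i]^o))
  (E Em : 'Hom(subvs_of t, R[i]^o) -> g) (tau : {linear g -> g})
  (Delta_base : root_base Phi Delta)
  (E_vect : simple_root_vectors br Delta E Em)
  (tau_transp : transposition br Delta E Em tau)
  (* parabolic filtration and parameter *)
  (r : nat) (r_gt0 : (0 < r)%N)
  (psi : nat -> {pred 'Hom(subvs_of t, R[i]^o)})
  (psi_filt : parabolic_filtration Phi r psi)
  (lam : 'I_r -> 'Hom(subvs_of t, R[i]^o))
  (lam_central : levi_central br psi lam)
  (* enveloping algebras of g_r, of the parabolic and of the Levi *)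
  (U Up Ul : algType R[i])
  (inc : {linear takiff g r -> U})
  (incp : {linear subvs_of (parabolic_alg br r Phi psi) -> Up})
  (incl : {linear subvs_of (levi br r Phi psi) -> Ul})
  (U_env : enveloping (takiff_br br (r:=r)) inc)
  (Up_env : enveloping (@sub_br _ _ (takiff_br br (r:=r)) _) incp)
  (Ul_env : enveloping (@sub_br _ _ (takiff_br br (r:=r)) _) incl)
  (* the character, on Up and on Ul *)
  (chip : {lrmorphism Up -> R[i]^o}) (chil : {lrmorphism Ul -> R[i]^o})
  (chipE : forall X, chip (incp X) = takiff_char br Phi lam (vsval X))
  (chilE : forall X, chil (incl X) = takiff_char br Phi lam (vsval X))
  (* the module M and its canonical generator ten 1 1 *)
  (j : {lrmorphism Up -> U}) (jE : forall X, j (incp X) = inc (vsval X))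
  (M : lmodType U) (ten : U -> R[i] -> M)
  (M_ind : induced_module j chip ten)
  (* transposition on U and projection onto Ul *)
  (T : {linear U -> U}) (T_anti : anti_automorphism T)
  (TE : forall X, T (inc X) = inc (takiff_map tau X))
  (bm bu : seq (takiff g r)) (bl : seq (subvs_of (levi br r Phi psi)))
  (bm_basis : basis_of (nil_minus br r Phi psi) bm)
  (bl_basis : basis_of fullv bl)
  (bu_basis : basis_of (nil_plus br r Phi psi) bu)
  (pi : {linear U -> Ul}) (pi_proj : pbw_projection inc incl bm bl bu pi) :
  sum_proper_submodules M = radical (shapovalov_mod T pi chil (ten 1 1)).
Proof.
case: tau_transp => tauK tau_br tau_t _.
exact: (@shapovalov_radical _ g br t Phi g_lie g_red t_cartan Phi_roots
  tau tauK tau_br tau_t r psi lam r_gt0 psi_filt U Up Ul inc incp incl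
  U_env Up_env chip chil chipE chilE j jE M ten M_ind T T_anti TE
  bm bu bl bm_basis bl_basis bu_basis pi pi_proj).
Qed.
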